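(* Let $h>0$ be fixed, let $u_0\in L^1(\mathbb{R}^N)\cap L^\infty(\mathbb{R}^N)$ and let $f$ be measurable on $Q_T$ with $\int_0^T\big(\|f(\cdot,t)\|_{L^1(\mathbb{R}^N)}+\|f(\cdot,t)\|_{L^\infty(\mathbb{R}^N)}\big)\,dt<\infty$. Assume that the scheme (S) is admissible (as defined in the context). Then there exists a unique a.e.-solution $(U_h^j)_{j}$ of the scheme (S) with $U_h^j\in L^1(\mathbb{R}^N)\cap L^\infty(\mathbb{R}^N)$ for all $j\in\{1,\dots,J\}$.
   Context: Let $N\in\mathbb{N}$, $T>0$, $Q_T=\mathbb{R}^N\times(0,T)$. Operators: for a nonnegative symmetric (i.e. $\nu(-B)=\nu(B)$) Radon measure $\nu$ on $\mathbb{R}^N\setminus\{0\}$ with finite total mass, write $\mathcal{L}^\nu[\psi](x)=\int(\psi(x+z)-\psi(x))\,d\nu(z)$ and $\nu(\mathbb{R}^N)$ for the total mass. When $\psi$ is only defined a.e., a Borel representative is used (changing the representative changes $\mathcal{L}^\nu[\psi]$ only on a null set). Time grid: $0=t_0<t_1<\dots<t_J=T$ (possibly nonuniform), $\Delta t_j=t_j-t_{j-1}$, $\Delta t=\max_j\Delta t_j$, and $F^j(x)=\frac1{\Delta t_j}\int_{t_{j-1}}^{t_j}f(x,t)\,dt$. Scheme (S): $U_h^0=u_0$ and, for $j=1,\dots,J$, $$U_h^j(x)=U_h^{j-1}(x)+\Delta t_j\Big(\mathcal{L}^{\nu_1^h}[\varphi_1^h(U_h^j)](x)+\mathcal{L}^{\nu_2^h}[\varphi_2^h(U_h^{j-1})](x)+F^j(x)\Big).$$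 An a.e.-solution satisfies this identity for a.e. $x\in\mathbb{R}^N$, for every $j$. The scheme is called admissible if: $\nu_1^h,\nu_2^h$ are nonnegative symmetric Radon measures on $\mathbb{R}^N\setminus\{0\}$ with finite total mass; $\varphi_1^h:\mathbb{R}\to\mathbb{R}$ is nondecreasing and continuous; $\varphi_2^h:\mathbb{R}\to\mathbb{R}$ is nondecreasing and locally Lipschitz; and the CFL condition $\Delta t\,L_{\varphi_2^h}\,\nu_2^h(\mathbb{R}^N)\le1$ holds, where $L_{\varphi_2^h}$ is the Lipschitz constant of $\varphi_2^h$ on $[-M,M]$ with $M=\|u_0\|_{L^\infty(\mathbb{R}^N)}+\int_0^T\|f(\cdot,\tau)\|_{L^\infty(\mathbb{R}^N)}\,d\tau$. *)

(* Defs.v *)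
From HB Require Import structures.
From mathcomp Require Import all_boot all_order all_algebra.
From mathcomp Require Import all_classical all_reals all_analysis.
From mathcomp Require Import measurable_realfun.

Set Implicit Arguments.
Unset Strict Implicit.
Unset Printing Implicit Defensive.

Import Order.TTheory GRing.Theory Num.Theory.
Import numFieldNormedType.Exports.

Local Open Scope classical_set_scope.
Local Open Scope ring_scope.

(* 'rV[R]_N carries its Borel sigma-algebra. *)
HB.instance Definition _ (R : realType) (m n : nat) :=
  @isMeasurable.Build (sigma_display (@open 'M[R]_(m, n))) 'M[R]_(m, n)
    <<s @open 'M[R]_(m, n) >>
    (@sigma_algebra0 _ setT _) (@sigma_algebraC _ _)
    (@sigma_algebra_bigcup _ setT _).

Section matrix_measurability.
Context {R : realType} (m n : nat).

Lemma open_measurable_mx (U : set 'M[R]_(m, n)) : open U -> measurable U.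
Proof. exact: sub_sigma_algebra. Qed.

Lemma measurable_mx_coord (i : 'I_m) (j : 'I_n) :
  measurable_fun [set: 'M[R]_(m, n)] (fun A : 'M[R]_(m, n) => A i j).
Proof.
apply: (measurability _ (RGenOpens.measurableE R)).
move=> _ [_ [a [b ->]] <-]; rewrite setTI; apply: open_measurable_mx.
by apply: open_comp => [A _|]; [exact: coord_continuous|exact: interval_open].
Qed.

Lemma mx_open_bigcup_ball (U : set 'M[R]_(m, n)) : open U ->
  U = \bigcup_(p : 'M[rat]_(m, n) * nat)
    let B := ball (map_mx (@ratr R) p.1) (p.2.+1%:R^-1 : R) in
    if `[< B `<=` U >] then B else set0.
Proof.
move=> oU; apply/seteqP; split => [A UA|A [p _]]; last first.
  by rewrite /=; case: asboolP => // BU; exact: BU.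
have /nbhs_ballP[e /= e0 eU] : nbhs A U by move: oU; rewrite openE; exact.
pose k := Num.truncn (2 / e); have ke : k.+1%:R^-1 < e / 2.
  rewrite invf_plt ?posrE ?divr_gt0// invf_div.
  by rewrite truncnS_gt.
have /choice[q Aq] : forall ij : 'I_m * 'I_n, exists q : rat,
    `|A ij.1 ij.2 - ratr q| < k.+1%:R^-1.
  move=> [i j] /=.
  have [|q] := @rat_in_itvoo R (A i j - k.+1%:R^-1) (A i j + k.+1%:R^-1).
    by rewrite ltrD2l gtrN// invr_gt0.
  rewrite in_itv/= => /andP[q1 q2]; exists q.
  by rewrite ltr_distlC q1 q2.
exists (\matrix_(i, j) q (i, j), k) => //=.
have AB : ball (map_mx (@ratr R) (\matrix_(i, j) q (i, j))) k.+1%:R^-1 A.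
  split=> [|i j]; first by rewrite invr_gt0.
  by rewrite !mxE; apply: ball_sym; exact: (Aq (i, j)).
case: asboolP => // -[] B qB; apply/eU/le_ball/(ball_triangle (ball_sym AB) qB).
by rewrite (splitr e) lerD// ltW.
Qed.

Lemma measurable_fun_mxP d (T : measurableType d) (f : T -> 'M[R]_(m, n)) :
  measurable_fun setT f <->
  forall i j, measurable_fun setT (fun x => f x i j).
Proof.
split=> [mf i j|mf].
  by apply: (measurableT_comp (measurable_mx_coord i j)).
apply: (measurability (@open 'M[R]_(m, n))) => //.
move=> _ [U oU <-]; rewrite setTI (mx_open_bigcup_ball oU).
rewrite preimage_bigcup; apply: countable_bigcupT_measurable => // -[q k] /=.
case: asboolP => _; last by rewrite preimage_set0.
rewrite (_ : _ @^-1` _ =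
  \bigcap_(ij in [set: 'I_m * 'I_n])
    ((fun x => f x ij.1 ij.2) @^-1` ball (ratr (q ij.1 ij.2) : R) k.+1%:R^-1)).
  apply: fin_bigcap_measurable => // -[i j] _ /=.
  rewrite -[X in measurable X]setTI.
  by apply: mf => //; exact: measurable_ball.
apply/seteqP; split => x.
  by move=> [_ h] [i j] _ /=; have := h i j; rewrite mxE.
by move=> h; split=> [|i j]; rewrite ?invr_gt0// mxE; exact: (h (i, j)).
Qed.

End matrix_measurability.
Lemma sigma_finite_product d1 d2 (T1 : measurableType d1)
    (T2 : measurableType d2) (R : realType)
    (m1 : {sigma_finite_measure set T1 -> \bar R})
    (m2 : {sigma_finite_measure set T2 -> \bar R}) :
  sigma_finite setT (m1 \x m2)%E.
Proof.
have /sigma_finiteP[F [TF ndF Foo]] := sigma_finiteT m1.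
have /sigma_finiteP[G [TG ndG Goo]] := sigma_finiteT m2.
exists (fun n => F n `*` G n).
  rewrite -setXTT TF TG predeqE => -[x y]; split.
    move=> [/= [n _ Fnx] [k _ Gky]]; exists (maxn n k) => //; split.
    - by move: x Fnx; exact/subsetPset/ndF/leq_maxl.
    - by move: y Gky; exact/subsetPset/ndG/leq_maxr.
  by move=> [n _ []/= ? ?]; split; exists n.
move=> k; have [? ?] := Foo k; have [? ?] := Goo k.
split; first exact: measurableX.
by rewrite product_measure1E// lte_mul_pinfty// ge0_fin_numE.
Qed.

Section lebesgue_measure_rV.
Context {R : realType}.

Definition cons_rV n (p : measurableTypeR R * 'rV[R]_n) : 'rV[R]_n.+1 :=
  row_mx (const_mx p.1 : 'M[R]_1) p.2.

Definition uncons_rV n (x : 'rV[R]_n.+1) : measurableTypeR R * 'rV[R]_n :=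
  (x ord0 ord0, \row_j x ord0 (lift ord0 j)).

Lemma cons_rV0 n (p : measurableTypeR R * 'rV[R]_n) : cons_rV p ord0 ord0 = p.1.
Proof.
by rewrite /cons_rV mxE; case: splitP => [i _|[]//]; rewrite mxE.
Qed.

Lemma cons_rVS n (p : measurableTypeR R * 'rV[R]_n) (j : 'I_n) :
  cons_rV p ord0 (lift ord0 j) = p.2 ord0 j.
Proof.
rewrite /cons_rV mxE; case: splitP => [[[]]//|i /= /eqP].
by rewrite eqSS => /eqP/val_inj ->.
Qed.

Lemma cons_rVK n : cancel (@cons_rV n) (@uncons_rV n).
Proof.
move=> [a x]; rewrite /uncons_rV cons_rV0; congr pair.
by apply/rowP => j; rewrite mxE cons_rVS.
Qed.

Lemma measurable_cons_rV n : measurable_fun setT (@cons_rV n).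
Proof.
apply/measurable_fun_mxP => i j; rewrite (ord1 i).
case: (unliftP ord0 j) => [k|] ->.
  apply: (eq_measurable_fun (fun p : _ * 'rV[R]_n => p.2 ord0 k)).
    by move=> p _; rewrite cons_rVS.
  exact: measurableT_comp (measurable_mx_coord ord0 k) measurable_snd.
apply: (eq_measurable_fun (fun p : measurableTypeR R * 'rV[R]_n => p.1)).
  by move=> p _; rewrite cons_rV0.
exact: measurable_fst.
Qed.

Lemma measurable_uncons_rV n : measurable_fun setT (@uncons_rV n).
Proof.
apply/measurable_fun_pair => /=.
  exact: measurable_mx_coord.
apply/measurable_fun_mxP => i j.
apply: (eq_measurable_fun (fun x : 'rV[R]_n.+1 => x ord0 (lift ord0 j))).
  by move=> x _; rewrite mxE.
exact: measurable_mx_coord.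
Qed.

Section step.
Local Open Scope ereal_scope.
Context n (mu : {sigma_finite_measure set 'rV[R]_n -> \bar R}).

Definition lebesgue_measure_step :=
  pushforward (lebesgue_measure \x mu) (@cons_rV n).

Let step0 : lebesgue_measure_step set0 = 0.
Proof.
by rewrite /lebesgue_measure_step /pushforward preimage_set0 measure0.
Qed.

Let step_ge0 A : 0 <= lebesgue_measure_step A.
Proof. by rewrite /lebesgue_measure_step /pushforward. Qed.

Let step_sigma_additive : semi_sigma_additive lebesgue_measure_step.
Proof.
unshelve (refine (@measure_semi_sigma_additive _ _ _
  (pushforward (lebesgue_measure \x mu) (@cons_rV n)
     : {measure set 'rV[R]_n.+1 -> \bar R}))).
exact: measurable_cons_rV.
Qed.

HB.instance Definition _ := isMeasure.Build _ _ _ lebesgue_measure_step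
  step0 step_ge0 step_sigma_additive.

Let step_sigma_finite : sigma_finite setT lebesgue_measure_step.
Proof.
have [F FT Foo] := sigma_finite_product lebesgue_measure mu.
exists (fun k => @uncons_rV n @^-1` F k).
  by rewrite -preimage_bigcup -FT preimage_setT.
move=> k; have [mF Fkoo] := Foo k; split.
  by rewrite -[X in measurable X]setTI; exact: measurable_uncons_rV.
rewrite /lebesgue_measure_step /pushforward -comp_preimage.
by rewrite (_ : _ \o _ = id)//; apply/funext => p /=; rewrite cons_rVK.
Qed.

HB.instance Definition _ := Measure_isSigmaFinite.Build _ _ _
  lebesgue_measure_step step_sigma_finite.

End step.

End lebesgue_measure_rV.

(* The N-dimensional Lebesgue measure as an iterated product. *)
Fixpoint lebesgue_measure_rV {R : realType} n :
    {sigma_finite_measure set 'rV[R]_n -> \bar R} :=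
  match n with
  | 0 => \d_(0 : 'rV[R]_0)
  | n'.+1 => lebesgue_measure_step (lebesgue_measure_rV n')
  end.

Lemma lebesgue_measure_rV_box {R : realType} n
    (A : 'I_n -> set (measurableTypeR R)) :
  (forall i, measurable (A i)) ->
  lebesgue_measure_rV n [set x : 'rV[R]_n | forall i, A i (x ord0 i)] =
  (\prod_(i < n) lebesgue_measure (A i))%E.
Proof.
elim: n A => [|n IHn] A mA.
  rewrite big_ord0 /= diracE mem_set// => -[]//.
have mB : measurable
    [set x : 'rV[R]_n | forall i, A (lift ord0 i) (x ord0 i)].
  rewrite (_ : mkset _ = \bigcap_(i in setT)
      ((fun x : 'rV[R]_n => x ord0 i) @^-1` A (lift ord0 i))).
    apply: fin_bigcap_measurable => // i _; rewrite -[X in measurable X]setTI.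
    exact: (measurable_mx_coord ord0 i measurableT (mA (lift ord0 i))).
  by apply/seteqP; split=> [x h i _|x h i]; exact: h.
rewrite big_ord_recl -IHn// -product_measure1E//=.
rewrite /lebesgue_measure_step /pushforward; congr (_ _).
apply/seteqP; split=> [p h|p [p1 p2] i] /=.
  by split=> [|i]; [rewrite -cons_rV0|rewrite -cons_rVS].
by case: (unliftP ord0 i) => [k|] ->; rewrite ?cons_rV0 ?cons_rVS//; exact: p2.
Qed.

(* Measurability with respect to the mu-completion of the sigma-algebra; for
   the Lebesgue measure this is Lebesgue measurability. *)
Definition completed_measurable_fun d (T : measurableType d)
    d' (T' : measurableType d') (R : realType)
    (mu : {measure set T -> \bar R}) (D : set T) (f : T -> T') :=
  exists2 g : T -> T', measurable_fun D g &
    {ae mu, forall x, D x -> f x = g x}.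

Section scheme.
Context {R : realType} {N : nat}.
Local Notation rV := 'rV[R]_N.
Local Notation leb := (@lebesgue_measure_rV R N).

Implicit Types (nu : {finite_measure set rV -> \bar R}) (psi u : rV -> R)
  (f : rV -> R -> R) (phi : R -> R) (t : nat -> R) (T : R) (J : nat).

(* A finite Radon measure on R^N \ {0} is encoded as a finite Borel measure on
   R^N without mass at the origin; the Radon property is then automatic. *)
Definition levy_symmetric nu :=
  nu [set 0] = 0%E /\
  forall B : set rV, measurable B -> nu [set - z | z in B] = nu B.

Definition levy_op nu psi (x : rV) : R := \int[nu]_z (psi (x + z) - psi x).

Definition time_grid t T J :=
  [/\ t 0%N = 0, t J = T & forall j, (j < J)%N -> t j < t j.+1].

Definition time_step t j : R := t j - t j.-1.

Definition max_time_step t J : R :=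
  \big[Num.max/0]_(1 <= j < J.+1) time_step t j.

Definition source_mean f t j (x : rV) : R :=
  (time_step t j)^-1 * \int[lebesgue_measure]_(s in `]t j.-1, t j[) f x s.

Definition source_integrable f T :=
  completed_measurable_fun (leb \x lebesgue_measure)%E ([set: rV] `*` `]0, T[)
    (fun p : rV * measurableTypeR R => f p.1 p.2) /\
  (\int[lebesgue_measure]_(s in `]0%R, T[)
     ('N[leb]_1[EFin \o f ^~ s] + 'N[leb]_+oo[EFin \o f ^~ s]) < +oo)%E.

Definition sup_bound u0 f T : R :=
  fine ('N[leb]_+oo[EFin \o u0] +
        \int[lebesgue_measure]_(s in `]0%R, T[) 'N[leb]_+oo[EFin \o f ^~ s])%E.

(* The infimum is attained as soon as phi is Lipschitz on A; a phi that is not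
   gets the junk value inf set0 = 0. *)
Definition lipschitz_const phi (A : set R) : R :=
  inf [set k | 0 <= k /\ k.-lipschitz_A phi].

Record admissible u0 f T t J (nu1 nu2 : {finite_measure set rV -> \bar R})
    (phi1 phi2 : R -> R) : Prop := Admissible {
  admissible_nu1 : levy_symmetric nu1 ;
  admissible_nu2 : levy_symmetric nu2 ;
  admissible_phi1_nd : {homo phi1 : x y / x <= y} ;
  admissible_phi1_continuous : continuous phi1 ;
  admissible_phi2_nd : {homo phi2 : x y / x <= y} ;
  admissible_phi2_lipschitz : [locally lipschitz phi2] ;
  admissible_CFL :
    let M := sup_bound u0 f T in
    ((max_time_step t J * lipschitz_const phi2 `[- M, M])%:E * nu2 setT <= 1)%E
}.

(* Only the values U j for j <= J are relevant. *)
Definition ae_solution u0 f t J (nu1 nu2 : {finite_measure set rV -> \bar R})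
    (phi1 phi2 : R -> R) (U : nat -> rV -> R) :=
  U 0%N = u0 /\
  forall j, (1 <= j <= J)%N ->
    {ae leb, forall x, U j x = U j.-1 x + time_step t j *
      (levy_op nu1 (phi1 \o U j) x + levy_op nu2 (phi2 \o U j.-1) x
       + source_mean f t j x)}.

(* Elements of Lfun are Borel functions: classes in L^1 and L^oo are handled
   through Borel representatives, so that psi (x + z) makes sense for a measure
   nu that may be singular. *)
Definition L1_Linfty (u : rV -> R) :=
  u \in Lfun leb 1%E /\ u \in Lfun leb +oo%E.

End scheme.

(* Main.v *)
(* Write m for the mass of nu1 and P h(x) = int h(x + z) dnu1(z), so that one
   step reads w + c m phi1(w) = g + c P(phi1(w)), where c is the time step and
   g, known from the previous step, lies in L^1 and L^oo.

   Existence. The map r |-> r + c m phi1(r) has a nondecreasing inverse and P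
   is order preserving, so the equation can be iterated monotonically between
   an ordered pair of a sub- and a supersolution. For g >= 0 the constants 0
   and sup g form such a pair, and the iteration started at 0 satisfies
   int w_i <= int g because translation invariance gives int P h = m int h.
   The solutions for min(g, 0) and max(g, 0) then form an ordered integrable
   pair for a signed g.

   Uniqueness. If e = |w - v| and k = |phi1(w) - phi1(v)| for two solutions,
   then e + c m k <= c P k, whence for delta > 0
   e 1_{k >= delta} + c m (k - delta)^+ <= c P((k - delta)^+).
   As (k - delta)^+ is integrable, integrating gives e = 0 on {k >= delta};
   so k = 0 a.e., and then e <= c P k = 0 a.e. *)

Require Import Defs.
From HB Require Import structures.
From mathcomp Require Import all_boot all_order all_algebra.
From mathcomp Require Import all_classical all_reals all_analysis.
From mathcomp Require Import measurable_realfun ess_sup_inf ring lra.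

Set Implicit Arguments.
Unset Strict Implicit.
Unset Printing Implicit Defensive.

Import Order.TTheory GRing.Theory Num.Theory.
Import numFieldNormedType.Exports.

Local Open Scope classical_set_scope.
Local Open Scope ring_scope.

(** * Translation invariance of the Lebesgue measure *)

Section translation.
Context {R : realType}.
Local Open Scope ereal_scope.

(** Lebesgue measure is determined by its values on half-open intervals, and a translation preserves
    their length. *)
Lemma lebesgue_measure_translation (a : R) (A : set R) : measurable A ->
  pushforward lebesgue_measure ((fun x => x + a)%R : _ -> measurableTypeR R) A =
  lebesgue_measure A.
Proof.
have ma : measurable_fun setT
    ((fun x => x + a)%R : measurableTypeR R -> measurableTypeR R).
  exact: (@measurable_funD _ (measurableTypeR R) R setT id (cst a)).
move=> mA; apply/esym.
apply: (lebesgue_measure_unique (mu := pushforward lebesgue_measure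
  ((fun x => x + a)%R : measurableTypeR R -> measurableTypeR R))) => //.
move=> _ [[b c]] _ <-.
rewrite /= /pushforward (_ : _ @^-1` _ = `](b - a)%R, (c - a)%R]%classic).
  by rewrite !lebesgue_measure_itv/= !lte_fin ltrD2r -!EFinB opprB addrA subrK.
by apply/seteqP; split=> x /=; rewrite !in_itv/= ltrBlDr lerBrDr.
Qed.

Lemma ge0_integral_lebesgue_translation (a : R) (f : measurableTypeR R -> \bar R) :
  measurable_fun setT f -> (forall x, 0 <= f x) ->
  \int[lebesgue_measure]_x f (x + a)%R = \int[lebesgue_measure]_x f x.
Proof.
move=> mf f0.
have ma : measurable_fun setT
    ((fun x => x + a)%R : measurableTypeR R -> measurableTypeR R).
  exact: (@measurable_funD _ (measurableTypeR R) R setT id (cst a)).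
have := @ge0_integral_pushforward _ _ (measurableTypeR R) (measurableTypeR R) R
  _ ma lebesgue_measure setT f measurableT mf (fun _ _ => f0 _).
rewrite preimage_setT => <-.
by apply: eq_measure_integral => A mA _; exact: lebesgue_measure_translation.
Qed.

Lemma measurable_addrV n d (T : measurableType d) (f g : T -> 'rV[R]_n) :
  measurable_fun setT f -> measurable_fun setT g ->
  measurable_fun setT (fun x => f x + g x)%R.
Proof.
move=> /measurable_fun_mxP mf /measurable_fun_mxP mg.
apply/measurable_fun_mxP => i j.
apply: (eq_measurable_fun (fun x => f x i j + g x i j)%R).
  by move=> x _; rewrite mxE.
exact: measurable_funD.
Qed.

Lemma cons_rVD n (p q : measurableTypeR R * 'rV[R]_n) :
  (cons_rV p + cons_rV q = cons_rV ((p.1 + q.1)%R : measurableTypeR R, p.2 + q.2))%R.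
Proof.
apply/rowP => j; rewrite mxE; case: (unliftP ord0 j) => [k|] ->.
  by rewrite !cons_rVS mxE.
by rewrite !cons_rV0.
Qed.

Lemma uncons_rVK n : cancel (@uncons_rV R n) (@cons_rV R n).
Proof.
move=> x; apply/rowP => j; case: (unliftP ord0 j) => [k|] ->.
  by rewrite cons_rVS mxE.
by rewrite cons_rV0.
Qed.

(** Splits off the first coordinate: the measure in dimension [n.+1] is the image of a product under
    [cons_rV], so a change of variables and Tonelli apply. *)
Lemma ge0_integral_rV_cons n (f : 'rV[R]_n.+1 -> \bar R) :
  measurable_fun setT f -> (forall x, 0 <= f x) ->
  \int[lebesgue_measure_rV n.+1]_x f x =
  \int[lebesgue_measure]_a \int[lebesgue_measure_rV n]_x f (cons_rV (a, x)).
Proof.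
move=> mf f0.
have mc := @measurable_cons_rV R n.
transitivity (\int[lebesgue_measure \x lebesgue_measure_rV n]_p f (cons_rV p)).
  have := @ge0_integral_pushforward _ _ _ _ R _ mc
    (lebesgue_measure \x lebesgue_measure_rV n) setT f measurableT mf (fun _ _ => f0 _).
  rewrite preimage_setT => <-.
  by apply: eq_measure_integral => A mA _.
by rewrite fubini_tonelli1//; exact: measurableT_comp.
Qed.

(** Induction on the dimension: the inner integral absorbs the shift of the last [n] coordinates,
    and the one-dimensional case absorbs that of the first. *)
Lemma ge0_integral_rV_translation n (z : 'rV[R]_n) (f : 'rV[R]_n -> \bar R) :
  measurable_fun setT f -> (forall x, 0 <= f x) ->
  \int[lebesgue_measure_rV n]_x f (x + z)%R = \int[lebesgue_measure_rV n]_x f x.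
Proof.
elim: n z f => [|n IHn] z f mf f0.
  by apply: eq_integral => x _; rewrite (_ : x + z = x)%R//; apply/rowP => -[].
rewrite !ge0_integral_rV_cons//; last first.
  by apply: measurableT_comp => //; exact: measurable_addrV.
have mc := @measurable_cons_rV R n.
rewrite -{1}(uncons_rVK z); case: (uncons_rV z) => b y.
under eq_integral => a _.
  under eq_integral do rewrite cons_rVD/=.
  rewrite (IHn y (fun x => f (cons_rV ((a + b)%R : measurableTypeR R, x))))//;
    last first.
    exact: (measurableT_comp (measurableT_comp mf mc)
      (pair1_measurable ((a + b)%R : measurableTypeR R))).
  over.
pose F (a : measurableTypeR R) := \int[lebesgue_measure_rV n]_x f (cons_rV (a, x)).
apply: (ge0_integral_lebesgue_translation b (f := F)).
  by apply: (measurable_fun_fubini_tonelli_F (m2 := lebesgue_measure_rV n)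
    _ (measurableT_comp mf mc)) => p; exact: f0.
by move=> a; exact: integral_ge0.
Qed.

End translation.

(** * Null sets of a product measure and their sections *)

Section ae_product.
Context d1 d2 (T1 : measurableType d1) (T2 : measurableType d2) {R : realType}.
Variables (m1 : {sigma_finite_measure set T1 -> \bar R})
  (m2 : {sigma_finite_measure set T2 -> \bar R}).
Local Open Scope ereal_scope.

Lemma product_measureE2 (A : set (T1 * T2)) : measurable A ->
  (m1 \x m2) A = \int[m2]_y m1 (ysection A y).
Proof.
by move=> mA; apply: (product_measure_unique (m' := m1 \x^ m2)) => // B C mB mC;
  exact: product_measure2E.
Qed.

Lemma product_measure_eq0 (A : set (T1 * T2)) : measurable A ->
  {ae m2, forall y, m1 (ysection A y) = 0} -> (m1 \x m2) A = 0.
Proof.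
move=> mA A0; rewrite product_measureE2//.
rewrite (ge0_ae_eq_integral (g := cst 0))// ?integral0//.
  exact: measurable_fun_ysection.
by apply: filterS A0 => y.
Qed.

(** The measures of the sections of a null set integrate to 0, so almost every section is null. *)
Lemma ae_product1 (P : T1 * T2 -> Prop) : {ae (m1 \x m2), forall p, P p} ->
  {ae m1, forall x, {ae m2, forall y, P (x, y)}}.
Proof.
move=> [A [mA A0 PA]].
have : ae_eq m1 setT (fun x => m2 (xsection A x)) (cst 0).
  apply/ae_eq_integral_abs => //; first exact: measurable_fun_xsection.
  rewrite -[RHS]A0; apply: eq_integral => x _.
  by rewrite gee0_abs.
apply: filterS => x /(_ I) Ax0; exists (xsection A x); split => //.
  exact: measurable_xsection.
by move=> y /= nPxy; apply/xsectionP; apply: PA.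
Qed.

Lemma ae_product2 (P : T1 * T2 -> Prop) : {ae (m1 \x m2), forall p, P p} ->
  {ae m2, forall y, {ae m1, forall x, P (x, y)}}.
Proof.
move=> [A [mA A0 PA]].
have : ae_eq m2 setT (fun y => m1 (ysection A y)) (cst 0).
  apply/ae_eq_integral_abs => //; first exact: measurable_fun_ysection.
  rewrite -[RHS]A0 product_measureE2//; apply: eq_integral => x _.
  by rewrite gee0_abs.
apply: filterS => y /(_ I) Ay0; exists (ysection A y); split => //.
  exact: measurable_ysection.
by move=> x /= nPxy; apply/ysectionP; apply: PA.
Qed.

End ae_product.

(** * Translates averaged over a finite measure *)

Section convolution_measure.
Context {R : realType} {n : nat}.
Local Notation rV := 'rV[R]_n.
Local Notation leb := (@lebesgue_measure_rV R n).
Variable nu : {finite_measure set rV -> \bar R}.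
Local Open Scope ereal_scope.

Lemma measurable_fun_shift d (T : measurableType d) (h : rV -> T) (x : rV) :
  measurable_fun setT h -> measurable_fun setT (fun z => h (x + z)%R).
Proof. by move=> mh; apply: measurableT_comp => //; exact: measurable_addrV. Qed.

Lemma measurable_fun_addp d (T : measurableType d) (h : rV -> T) :
  measurable_fun setT h ->
  measurable_fun setT (fun p : rV * rV => h (p.1 + p.2)%R).
Proof. by move=> mh; apply: measurableT_comp => //; exact: measurable_addrV. Qed.

Lemma ge0_integral_shift (h : rV -> \bar R) :
  measurable_fun setT h -> (forall x, 0 <= h x) ->
  \int[leb]_x \int[nu]_z h (x + z)%R = nu setT * \int[leb]_x h x.
Proof.
move=> mh h0.
rewrite (@fubini_tonelli _ _ _ _ _ leb nu _ (measurable_fun_addp mh))//=.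
under eq_integral do rewrite /= ge0_integral_rV_translation//.
by rewrite integral_cst// muleC.
Qed.

(** The set of pairs with [x + z] in a null set [A] has translates of [A] as sections at fixed [z],
    so it is null for the product; then a.e. [x] has a [nu]-null section. This controls shifts even
    when [nu] is singular. *)
Lemma ae_shift (P : rV -> Prop) : {ae leb, forall x, P x} ->
  {ae leb, forall x, {ae nu, forall z, P (x + z)%R}}.
Proof.
move=> [A [mA A0 PA]].
pose B : set (rV * rV) := [set p | A (p.1 + p.2)%R].
have mB : measurable B.
  have := @measurable_fun_addp _ _ id (@measurable_id _ _ setT) measurableT A mA.
  by rewrite setTI.
apply: (@ae_product1 _ _ _ _ R leb nu (fun p => P (p.1 + p.2)%R)).
exists B; split => //; last by move=> p /= nP; apply: PA.
apply: (@product_measure_eq0 _ _ _ _ R leb nu) => //.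
apply: nearW => z; rewrite -A0.
(* Both measures become integrals of indicators, to which translation invariance applies. *)
rewrite -[LHS]mul1e -integral_cst//; last exact: measurable_ysection.
rewrite -[RHS]mul1e -integral_cst//.
rewrite integral_mkcond [in RHS]integral_mkcond -[RHS](ge0_integral_rV_translation z)//.
- apply: eq_integral => x _; rewrite !patchE.
  have -> // : (x \in ysection B z) = ((x + z)%R \in A).
  by rewrite mem_ysection; apply/idP/idP; rewrite !inE.
- apply/(measurable_restrictT _ mA). exact: measurable_cst.
- by move=> x; apply: erestrict_ge0.
Qed.

End convolution_measure.

(** * Convolution with a finite measure *)

Section bounded_borel.
Context d {T : measurableType d} {R : realType}.
Implicit Types (h k : T -> R) (phi : R -> R).

(** The bound holds everywhere, not just a.e.: such functions are integrable for every finite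
    measure, so nonlocal terms can be handled at each point. *)
Definition bounded_borel h :=
  measurable_fun setT h /\ exists K, forall x, `|h x| <= K.

Lemma bounded_borel_cst (a : R) : bounded_borel (fun=> a).
Proof. by split; [exact: measurable_cst|exists `|a|]. Qed.

Lemma bounded_borelD h k :
  bounded_borel h -> bounded_borel k -> bounded_borel (fun x => h x + k x).
Proof.
move=> [mh [K hK]] [mk [L kL]]; split; first exact: measurable_funD.
by exists (K + L) => x; rewrite (le_trans (ler_normD _ _))// lerD.
Qed.

Lemma bounded_borelN h : bounded_borel h -> bounded_borel (fun x => - h x).
Proof.
move=> [mh [K hK]]; split; first exact: measurableT_comp.
by exists K => x; rewrite normrN.
Qed.

Lemma bounded_borelB h k :
  bounded_borel h -> bounded_borel k -> bounded_borel (fun x => h x - k x).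
Proof. by move=> bh bk; apply: bounded_borelD => //; exact: bounded_borelN. Qed.

Lemma bounded_borelZ (a : R) h :
  bounded_borel h -> bounded_borel (fun x => a * h x).
Proof.
move=> [mh [K hK]]; split; first exact: measurable_funM.
by exists (`|a| * K) => x; rewrite normrM ler_wpM2l.
Qed.

Lemma measurable_homo phi :
  {homo phi : x y / x <= y} -> measurable_fun setT phi.
Proof.
move=> phind; apply: (measurability _ (RGenOInfty.measurableE R)).
move=> _ [_ [a ->] <-]; rewrite setTI; apply: is_interval_measurable.
move=> x y /=; rewrite !in_itv/= !andbT => ax ay z /andP[xz zy].
by rewrite /= in_itv/= andbT; exact: lt_le_trans ax (phind _ _ xz).
Qed.

Lemma bounded_borel_homo phi h : {homo phi : x y / x <= y} ->
  bounded_borel h -> bounded_borel (phi \o h).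
Proof.
move=> phind [mh [K hK]]; split.
  by apply: measurableT_comp => //; exact: measurable_homo.
exists (`|phi K| + `|phi (- K)|) => x /=.
have /ler_normlP[hl hu] := hK x.
have h1 : phi (h x) <= phi K by exact: phind.
have h2 : phi (- K) <= phi (h x) by apply: phind; rewrite lerNl.
have a1 := ler_norm (phi K); have a2 := ler_norm (- phi (- K)).
have a3 := normr_ge0 (phi K); have a4 := normr_ge0 (phi (- K)).
rewrite normrN in a2.
by rewrite ler_norml; apply/andP; split; lra.
Qed.

Lemma bounded_borel_integrable (mu : {finite_measure set T -> \bar R}) h :
  bounded_borel h -> mu.-integrable setT (EFin \o h).
Proof.
move=> [mh [K hK]]; apply: measurable_bounded_integrable => //.
  by rewrite ltey_eq fin_num_measure.
exists K; split; first exact: num_real.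
by move=> M KM x _; exact: le_trans (hK x) (ltW KM).
Qed.

End bounded_borel.

Section convolution.
Context {R : realType} {n : nat}.
Local Notation rV := 'rV[R]_n.
Local Notation leb := (@lebesgue_measure_rV R n).
Variable nu : {finite_measure set rV -> \bar R}.
Implicit Types (h k : rV -> R) (x : rV).

(** This is the usual convolution of [h] with the reflection of [nu] through the origin. *)
Definition convolution h x : R := \int[nu]_z h (x + z).

Definition total_mass : R := fine (nu setT).

Lemma total_massE : nu setT = total_mass%:E.
Proof. by rewrite fineK// fin_num_measure. Qed.

Lemma total_mass_ge0 : 0 <= total_mass.
Proof. exact: fine_ge0. Qed.

Lemma bounded_borel_shift h x :
  bounded_borel h -> bounded_borel (fun z : rV => h (x + z)).
Proof.
by move=> [mh [K hK]]; split; [exact: measurable_fun_shift|exists K => z].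
Qed.

Lemma integrable_shift h x :
  bounded_borel h -> nu.-integrable setT (EFin \o (fun z : rV => h (x + z))).
Proof.
by move=> bh; apply: bounded_borel_integrable; exact: bounded_borel_shift.
Qed.

Lemma convolution_EFin h x : bounded_borel h ->
  (convolution h x)%:E = (\int[nu]_z (h (x + z))%:E)%E.
Proof.
move=> bh; rewrite fineK//; apply: integrable_fin_num => //.
exact: integrable_shift.
Qed.

Lemma convolution_cst (a : R) x : convolution (fun=> a) x = a * total_mass.
Proof. by rewrite /convolution Rintegral_cst. Qed.

Lemma le_convolution h k x : bounded_borel h -> bounded_borel k ->
  (forall y, h y <= k y) -> convolution h x <= convolution k x.
Proof. by move=> bh bk hk; apply: le_Rintegral => //; exact: integrable_shift. Qed.

Lemma convolution_ge0 h x : (forall y, 0 <= h y) -> 0 <= convolution h x.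
Proof. by move=> h0; exact: Rintegral_ge0. Qed.

Lemma convolutionB h k x : bounded_borel h -> bounded_borel k ->
  convolution (fun y => h y - k y) x = convolution h x - convolution k x.
Proof. by move=> bh bk; apply: RintegralB => //; exact: integrable_shift. Qed.

Lemma norm_convolution h x : bounded_borel h ->
  `|convolution h x| <= convolution (fun y => `|h y|) x.
Proof. by move=> bh; apply: le_normr_Rintegral => //; exact: integrable_shift. Qed.

Lemma bounded_borel_norm h : bounded_borel h -> bounded_borel (fun y => `|h y|).
Proof.
move=> [mh [K hK]]; split; first exact: measurableT_comp.
by exists K => x; rewrite normr_id.
Qed.

Lemma levy_opE h x : bounded_borel h ->
  levy_op nu h x = convolution h x - total_mass * h x.
Proof.
move=> bh; rewrite /levy_op RintegralB//; last 2 first.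
- exact: integrable_shift.
- exact: bounded_borel_integrable (bounded_borel_cst _).
by rewrite Rintegral_cst// (mulrC _ total_mass).
Qed.

Lemma bounded_borel_convolution h : bounded_borel h -> bounded_borel (convolution h).
Proof.
move=> bh; have [mh [K hK]] := bh; split; last first.
  exists (K * total_mass) => x; rewrite (le_trans (norm_convolution _ bh))//.
  rewrite -(convolution_cst K x); apply: le_convolution => //.
    exact: bounded_borel_norm.
  exact: bounded_borel_cst.
(* Adding [K] makes the integrand nonnegative, so that Tonelli gives measurability; the constant is
   subtracted afterwards. *)
pose p := fun y => h y + K.
have p0 y : 0 <= p y.
  by have := hK y; rewrite /p => /ler_normlP[]; lra.
have bp : bounded_borel p by apply: bounded_borelD => //; exact: bounded_borel_cst.
have cE : convolution h = fun x => convolution p x - K * total_mass.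
  apply/funext => x; rewrite -(convolution_cst K x) -convolutionB//.
    by congr convolution; apply/funext => y; rewrite /p addrK.
  exact: bounded_borel_cst.
rewrite cE; apply: measurable_funB => //.
apply/measurable_EFinP.
apply: (eq_measurable_fun (fubini_F nu (fun q : rV * rV => (p (q.1 + q.2))%:E))).
  by move=> x _ /=; rewrite convolution_EFin.
apply: measurable_fun_fubini_tonelli_F => /= [|q]; last by rewrite lee_fin.
by apply: (@measurable_fun_addp _ _ _ _ (EFin \o p)); apply/measurable_EFinP; case: bp.
Qed.

Lemma bounded_borel_levy_op h : bounded_borel h -> bounded_borel (levy_op nu h).
Proof.
move=> bh; have -> : levy_op nu h = fun x => convolution h x - total_mass * h x.
  by apply/funext => x; exact: levy_opE.
apply: bounded_borelB; first exact: bounded_borel_convolution.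
exact: bounded_borelZ.
Qed.

(** The mass identity behind both the L^1 bound and uniqueness: Tonelli and translation
    invariance. *)
Lemma ge0_integral_convolution h : bounded_borel h -> (forall x, 0 <= h x) ->
  (\int[leb]_x (convolution h x)%:E = total_mass%:E * \int[leb]_x (h x)%:E)%E.
Proof.
move=> bh h0; under eq_integral do rewrite convolution_EFin//.
rewrite -total_massE -ge0_integral_shift//.
by apply/measurable_EFinP; case: bh.
Qed.

Lemma integrable_convolution h : bounded_borel h ->
  leb.-integrable setT (EFin \o h) -> leb.-integrable setT (EFin \o convolution h).
Proof.
move=> bh /integrableP[_ hoo]; apply/integrableP; split.
  by apply/measurable_EFinP; case: (bounded_borel_convolution bh).
have bnh := bounded_borel_norm bh.
apply: (@le_lt_trans _ _ (\int[leb]_x (convolution (fun y => `|h y|) x)%:E)%E).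
  apply: ge0_le_integral => //.
  - apply/measurable_EFinP; apply: measurableT_comp => //.
    by case: (bounded_borel_convolution bh).
  - by apply/measurable_EFinP; case: (bounded_borel_convolution bnh).
  - by move=> x _; rewrite lee_fin norm_convolution.
rewrite ge0_integral_convolution// lte_mul_pinfty// lee_fin.
exact: total_mass_ge0.
Qed.

Lemma cvg_convolution (h_ : nat -> rV -> R) h K x :
  (forall i, measurable_fun setT (h_ i)) -> measurable_fun setT h ->
  (forall i y, `|h_ i y| <= K) -> (forall y, h_ i y @[i --> \oo] --> h y) ->
  convolution (h_ i) x @[i --> \oo] --> convolution h x.
Proof.
move=> mh_ mh hK hh.
apply/fine_cvg.
have [] := @dominated_convergence _ _ R nu setT measurableT
  (fun i z => (h_ i (x + z))%:E) (fun z => (h (x + z))%:E) (fun=> K%:E).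
- by move=> i; apply/measurable_EFinP; exact: measurable_fun_shift.
- by apply/measurable_EFinP; exact: measurable_fun_shift.
- by apply: nearW => z _; apply: cvg_EFin; [exact: nearW|exact: hh].
- exact: bounded_borel_integrable (bounded_borel_cst K).
- by apply: nearW => z i _; rewrite lee_fin.
move=> ih _; rewrite fineK //.
exact: integrable_fin_num.
Qed.

(** Allows a change of representative inside the nonlocal operator: by [ae_shift], for a.e. [x] the
    two integrands agree [nu]-a.e. *)
Lemma ae_eq_levy_op (u v : rV -> R) (phi : R -> R) :
  {homo phi : x y / x <= y} ->
  measurable_fun setT u -> measurable_fun setT v ->
  {ae leb, forall x, u x = v x} ->
  {ae leb, forall x, levy_op nu (phi \o u) x = levy_op nu (phi \o v) x}.
Proof.
move=> /measurable_homo mphi mu mv uv.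
have uvs := ae_shift nu uv.
near=> x.
have uvx : u x = v x by near: x.
have uvxz : {ae nu, forall z, u (x + z) = v (x + z)} by near: x.
congr fine; apply: ae_eq_integral => //.
- apply/measurable_EFinP/measurable_funB => //.
  by apply: measurable_fun_shift; exact: measurableT_comp.
- apply/measurable_EFinP/measurable_funB => //.
  by apply: measurable_fun_shift; exact: measurableT_comp.
- by apply: filterS uvxz => z /= -> _; rewrite uvx.
Unshelve. all: by end_near. Qed.

End convolution.

(** * One implicit step: existence *)

(** The map [r + a * phi r] is continuous, strictly increasing and unbounded in both directions. *)
Lemma monotone_resolvent {R : realType} (phi : R -> R) (a : R) :
  {homo phi : x y / x <= y} -> continuous phi -> 0 <= a ->
  exists2 b : R -> R, {homo b : x y / x <= y} &
    forall y, b y + a * phi (b y) = y.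
Proof.
move=> phind phic a0.
pose beta r := r + a * phi r.
have betac : continuous beta.
  by move=> r; apply: cvgD; [exact: cvg_id|apply: cvgMr; exact: phic].
have /choice[b bE] : forall y, exists r, beta r = y.
  (* With this [M], monotonicity gives [beta M >= M + a * phi 0 >= y], and symmetrically at
     [- M]. *)
  move=> y; pose M := `|y - a * phi 0|.
  have M0 : 0 <= M by exact: normr_ge0.
  have yM : y <= beta M.
    have : a * phi 0 <= a * phi M by rewrite ler_wpM2l// phind.
    have := ler_norm (y - a * phi 0); rewrite -/M /beta; lra.
  have My : beta (- M) <= y.
    have : a * phi (- M) <= a * phi 0 by rewrite ler_wpM2l// phind// oppr_le0.
    have := ler_norm (- (y - a * phi 0)); rewrite normrN -/M /beta; lra.
  have [|||r _ <-] := @IVT R beta (- M) M y; last by exists r.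
  - by rewrite (le_trans _ M0)// oppr_le0.
  - exact: continuous_subspaceT.
  - by rewrite ge_min My le_max yM orbT.
exists b => // x y xy; rewrite leNgt; apply/negP => byx.
have := ler_wpM2l a0 (phind _ _ (ltW byx)).
by have := bE x; have := bE y; rewrite /beta; lra.
Qed.

Section implicit_step_existence.
Context {R : realType} {n : nat}.
Local Notation rV := 'rV[R]_n.
Local Notation leb := (@lebesgue_measure_rV R n).
Variables (nu : {finite_measure set rV -> \bar R}) (c : R).
Hypothesis c0 : 0 <= c.
Local Notation m := (total_mass nu).
Implicit Types (g w : rV -> R) (phi : R -> R).

(** Applying the inverse of [r + c * m * phi r] to the right-hand side is order preserving, so the
    iterates increase from [w0] and stay below [w1]. The iterates are part of the conclusion because
    the L^1 estimate is proved on them. *)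
Lemma monotone_iteration phi g w0 w1 :
  {homo phi : x y / x <= y} -> continuous phi ->
  bounded_borel g -> bounded_borel w0 -> bounded_borel w1 ->
  (forall x, w0 x <= w1 x) ->
  (forall x, w0 x + c * m * phi (w0 x) <=
     g x + c * convolution nu (phi \o w0) x) ->
  (forall x, g x + c * convolution nu (phi \o w1) x <=
     w1 x + c * m * phi (w1 x)) ->
  exists w_ : nat -> rV -> R, exists w,
    [/\ w_ 0%N = w0,
      forall i, bounded_borel (w_ i),
      forall i x, w_ i.+1 x + c * m * phi (w_ i.+1 x) =
        g x + c * convolution nu (phi \o w_ i) x,
      forall x, nondecreasing_seq (w_ ^~ x) &
      [/\ bounded_borel w, forall x, w_ i x @[i --> \oo] --> w x,
        forall x, w0 x <= w x <= w1 x &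
        forall x, w x + c * m * phi (w x) =
          g x + c * convolution nu (phi \o w) x]].
Proof.
move=> phind phic bg bw0 bw1 w01 sub super.
have cm0 : 0 <= c * m by rewrite mulr_ge0// total_mass_ge0.
have [b bnd bE] := monotone_resolvent phind phic cm0.
(* Strict monotonicity turns an inequality between left-hand sides into one between the unknowns. *)
have le_beta r s : r + c * m * phi r <= s + c * m * phi s -> r <= s.
  move=> rs; rewrite leNgt; apply/negP => sr.
  by have := ler_wpM2l cm0 (phind _ _ (ltW sr)); lra.
pose G w x := b (g x + c * convolution nu (phi \o w) x).
have bG w : bounded_borel w -> bounded_borel (G w).
  move=> bw; apply: (@bounded_borel_homo _ _ _ b (fun x => _)) => //.
  apply: bounded_borelD => //; apply: bounded_borelZ.
  by apply: bounded_borel_convolution; exact: bounded_borel_homo.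
have leG w w' : bounded_borel w -> bounded_borel w' ->
    (forall x, w x <= w' x) -> forall x, G w x <= G w' x.
  move=> bw bw' ww' x; apply: bnd; rewrite lerD2l ler_wpM2l//.
  apply: le_convolution => [||y]; [exact: bounded_borel_homo..|exact: phind].
pose w_ i := iter i G w0.
have bw_ i : bounded_borel (w_ i) by elim: i => //= i; exact: bG.
have w_S i x : w_ i.+1 x + c * m * phi (w_ i.+1 x) =
    g x + c * convolution nu (phi \o w_ i) x by exact: bE.
have w_le i x : w_ i x <= w_ i.+1 x.
  elim: i x => [|i ih] x; last exact: leG (bw_ i) (bw_ i.+1) ih x.
  by apply: le_beta; rewrite w_S.
have w_w1 i x : w_ i x <= w1 x.
  elim: i x => // i ih x; apply: le_beta; rewrite w_S (le_trans _ (super x))//.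
  rewrite lerD2l ler_wpM2l//; apply: le_convolution => [||y].
  - exact: bounded_borel_homo.
  - exact: bounded_borel_homo.
  - exact: phind.
have w_nd x : nondecreasing_seq (w_ ^~ x) by apply/nondecreasing_seqP => i.
have w_w0 i x : w0 x <= w_ i x by exact: (w_nd x 0%N i).
have w_cvg x : cvgn (w_ ^~ x).
  apply: nondecreasing_is_cvgn => //; exists (w1 x) => _ [i _ <-].
  exact: w_w1.
pose w x := limn (w_ ^~ x).
have w0w x : w0 x <= w x by apply: limr_ge => //; exact: nearW.
have ww1 x : w x <= w1 x by apply: limr_le => //; exact: nearW.
have [mw0 [K0 hK0]] := bw0; have [mw1 [K1 hK1]] := bw1.
have hK i x : `|w_ i x| <= K0 + K1.
  have := hK0 x; have := hK1 x; have := w_w0 i x; have := w_w1 i x.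
  by rewrite !ler_norml => ? ? /andP[? ?] /andP[? ?]; apply/andP; split; lra.
have bw : bounded_borel w.
  split.
    by apply: (@measurable_fun_cvg _ _ _ setT w_) => // i; case: (bw_ i).
  exists (K0 + K1) => x.
  have := hK0 x; have := hK1 x; have := w0w x; have := ww1 x.
  by rewrite !ler_norml => ? ? /andP[? ?] /andP[? ?]; apply/andP; split; lra.
exists w_, w; split => //; split => //.
  by move=> x; rewrite w0w ww1.
move=> x.
have phiw y : phi (w_ i y) @[i --> \oo] --> phi (w y).
  by apply: continuous_cvg; [exact: phic|exact: w_cvg].
(* The recurrence gives the same sequence two limits, one for each side of the equation. *)
have lhs : w_ i.+1 x + c * m * phi (w_ i.+1 x) @[i --> \oo] -->
    w x + c * m * phi (w x).
  rewrite (cvg_shiftS (fun i => w_ i x + c * m * phi (w_ i x))).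
  by apply: cvgD; [exact: w_cvg|apply: cvgMr; exact: phiw].
have rhs : w_ i.+1 x + c * m * phi (w_ i.+1 x) @[i --> \oo] -->
    g x + c * convolution nu (phi \o w) x.
  under eq_fun do rewrite w_S.
  apply: cvgD; first exact: cvg_cst.
  apply: cvgMr.
  (* All iterates take values between [- (K0 + K1)] and [K0 + K1], so the values of [phi] at these
     two ends bound [phi \o w_ i] uniformly in [i]. *)
  have [_ [L hL]] := bounded_borel_homo phind (bounded_borel_cst (T:=rV) (K0 + K1)).
  have [_ [L' hL']] := bounded_borel_homo phind (bounded_borel_cst (T:=rV) (- (K0 + K1))).
  apply: (@cvg_convolution _ _ _ (fun i => phi \o w_ i) _ (L + L')) => //.
  - by move=> i; case: (bounded_borel_homo phind (bw_ i)).
  - by case: (bounded_borel_homo phind bw).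
  move=> i y /=.
  have := hL 0; have := hL' 0 => /=.
  have /ler_normlP[h1 h2] := hK i y.
  have := phind _ _ h2.
  have : phi (- (K0 + K1)) <= phi (w_ i y) by apply: phind; rewrite lerNl.
  by rewrite !ler_norml => ? ? /andP[? ?] /andP[? ?]; apply/andP; split; lra.
exact: (cvg_unique _ lhs rhs).
Qed.

(* The L^1 bound comes from the mass balance of the iteration started at 0:
   each step adds int g and moves mass from the nonlinear to the linear term. *)
Lemma implicit_step_ge0 phi g :
  {homo phi : x y / x <= y} -> continuous phi -> phi 0 = 0 ->
  bounded_borel g -> leb.-integrable setT (EFin \o g) -> (forall x, 0 <= g x) ->
  exists w, [/\ bounded_borel w, leb.-integrable setT (EFin \o w),
    forall x, 0 <= w x &
    forall x, w x + c * m * phi (w x) = g x + c * convolution nu (phi \o w) x].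
Proof.
move=> phind phic phi0 bg ig g0.
have [mg [K hK]] := bg.
have cm0 : 0 <= c * m by rewrite mulr_ge0// total_mass_ge0.
have K0 : 0 <= K by exact: le_trans (hK 0).
have [|||w_ [w [w_0 bw_ w_S w_nd [bw w_w w01 wE]]]] :=
  @monotone_iteration phi g (cst 0) (cst K) phind phic bg
    (bounded_borel_cst _) (bounded_borel_cst _).
- by [].
- move=> x /=; rewrite phi0 mulr0 addr0 addr_ge0// mulr_ge0//.
  by apply: convolution_ge0 => y /=; rewrite phi0.
(* For the constant [K] the two terms in [phi K] cancel, and the supersolution condition reduces to
   [g x <= K]. *)
- move=> x /=.
  rewrite (_ : convolution nu (phi \o cst K) x = phi K * m); last first.
    exact: (convolution_cst nu (phi K) x).
  rewrite (mulrC (phi K)) mulrA lerD2r (le_trans _ (hK x))//.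
  exact: ler_norm.
have w_ge0 i x : 0 <= w_ i x.
  by have := w_nd x 0%N i isT; rewrite w_0.
have phi_ge0 r : 0 <= r -> 0 <= phi r by move=> r0; rewrite -phi0; exact: phind.
have mw_ i : measurable_fun setT (EFin \o w_ i).
  by apply/measurable_EFinP; case: (bw_ i).
have bphi i : bounded_borel (phi \o w_ i) by exact: bounded_borel_homo.
have mphi i : measurable_fun setT (EFin \o (phi \o w_ i)).
  by apply/measurable_EFinP; case: (bphi i).
pose A i := ((c * m)%:E * \int[leb]_x (phi (w_ i x))%:E)%E.
have balance i : (\int[leb]_x (w_ i.+1 x)%:E + A i.+1 =
    \int[leb]_x (g x)%:E + A i)%E.
  have -> : A i = (\int[leb]_x (c * convolution nu (phi \o w_ i) x)%:E)%E.
    under eq_integral do rewrite EFinM.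
    rewrite ge0_integralZl_EFin//.
    - by rewrite ge0_integral_convolution// ?muleA -?EFinM// => x; exact: phi_ge0.
    - by move=> x _; rewrite lee_fin; apply: convolution_ge0 => y; exact: phi_ge0.
    - by apply/measurable_EFinP; case: (bounded_borel_convolution nu (bphi i)).
  rewrite -ge0_integralD//; last 4 first.
  - by move=> x _; rewrite lee_fin.
  - exact/measurable_EFinP.
  - move=> x _; rewrite lee_fin mulr_ge0//.
    by apply: convolution_ge0 => y; exact: phi_ge0.
  - apply/measurable_EFinP; apply: measurable_funM => //.
    by case: (bounded_borel_convolution nu (bphi i)).
  rewrite /A -ge0_integralZl_EFin//; last 2 first.
  - by move=> x _; rewrite lee_fin phi_ge0.
  - exact: mphi.
  rewrite -ge0_integralD//; last 4 first.
  - by move=> x _; rewrite lee_fin.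
  - exact: mw_.
  - by move=> x _; rewrite -EFinM lee_fin mulr_ge0// phi_ge0.
  - by apply: measurable_funeM; exact: mphi.
  by apply: eq_integral => x _; rewrite -EFinM -!EFinD w_S.
have Ig : (\int[leb]_x (g x)%:E < +oo)%E by exact: integrable_lty.
have w_int_ge0 i : (0 <= \int[leb]_x (w_ i x)%:E)%E.
  by apply: integral_ge0 => x _; rewrite lee_fin.
have A_ge0 i : (0 <= A i)%E.
  by rewrite mule_ge0 ?lee_fin//; apply: integral_ge0 => x _; rewrite lee_fin phi_ge0.
(* [A 0] vanishes since [phi 0 = 0], and the balance propagates finiteness, which is needed to
   cancel [A i.+1] below. *)
have Aoo i : (A i < +oo)%E.
  elim: i => [|i ih].
    rewrite /A w_0; under eq_integral do rewrite /= phi0.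
    by rewrite integral0 mule0.
  rewrite (@le_lt_trans _ _ (\int[leb]_x (g x)%:E + A i)%E)//.
    by rewrite -balance leeDr.
  exact: lte_add_pinfty.
have A_nd i : (A i <= A i.+1)%E.
  rewrite lee_wpmul2l ?lee_fin//; apply: ge0_le_integral => //.
  - by move=> x _; rewrite lee_fin phi_ge0.
  - exact: mphi.
  - exact: mphi.
  - by move=> x _; rewrite lee_fin phind// w_nd.
(* The balance with [A i <= A i.+1], after cancelling [A i.+1]. *)
have w_bound i : (\int[leb]_x (w_ i x)%:E <= \int[leb]_x (g x)%:E)%E.
  case: i => [|i].
    rewrite w_0 integral0; apply: integral_ge0 => x _.
    by rewrite lee_fin.
  rewrite -(leeD2rE (x := A i.+1)) ?balance ?leeD2l//.
  by rewrite ge0_fin_numE.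
have w_ge0' x : 0 <= w x by have /andP[] := w01 x.
exists w; split => //.
apply/integrableP; split; first by apply/measurable_EFinP; case: bw.
have intE : (\int[leb]_x `|(w x)%:E| = limn (fun i => \int[leb]_x (w_ i x)%:E))%E.
  rewrite -monotone_convergence//.
  - apply: eq_integral => x _; rewrite gee0_abs ?lee_fin//.
    apply/esym/cvg_lim => //.
    by apply: cvg_EFin; [exact: nearW|exact: w_w].
  - by move=> i x _; rewrite lee_fin.
  - by move=> x _ i j ij; rewrite lee_fin w_nd.
rewrite (le_lt_trans _ Ig)// intE; apply: lime_le; last exact: nearW.
apply: ereal_nondecreasing_is_cvgn => i j ij; apply: ge0_le_integral => //.
- by move=> x _; rewrite lee_fin.
- exact: mw_.
- exact: mw_.
- by move=> x _; rewrite lee_fin w_nd.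
Qed.

Lemma convolutionN h x : bounded_borel h ->
  convolution nu (fun y => - h y) x = - convolution nu h x.
Proof.
move=> bh; have := @convolutionB _ _ nu (fun=> 0) h x (bounded_borel_cst 0) bh.
rewrite convolution_cst mul0r sub0r => <-.
by congr convolution; apply/funext => y; rewrite sub0r.
Qed.

(** Reflection: [- w] solves the equation for [- g] and the nonlinearity [- phi (- r)]. *)
Lemma implicit_step_le0 phi g :
  {homo phi : x y / x <= y} -> continuous phi -> phi 0 = 0 ->
  bounded_borel g -> leb.-integrable setT (EFin \o g) -> (forall x, g x <= 0) ->
  exists w, [/\ bounded_borel w, leb.-integrable setT (EFin \o w),
    forall x, w x <= 0 &
    forall x, w x + c * m * phi (w x) = g x + c * convolution nu (phi \o w) x].
Proof.
move=> phind phic phi0 bg ig g0.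
have [||||||w [bw iw w0 wE]] :=
  @implicit_step_ge0 (fun r => - phi (- r)) (fun x => - g x).
- by move=> x y xy; rewrite lerN2 phind// lerN2.
- move=> x; apply: continuousN; apply: continuous_comp; [exact: opp_continuous|].
  exact: phic.
- by rewrite oppr0 phi0 oppr0.
- exact: bounded_borelN.
- exact: integrableN ig.
- by move=> x; rewrite oppr_ge0.
exists (fun x => - w x); split.
- exact: bounded_borelN.
- exact: integrableN iw.
- by move=> x; rewrite oppr_le0.
move=> x; have := wE x.
rewrite (_ : convolution nu _ x = - convolution nu (phi \o (fun y => - w y)) x).
  lra.
by rewrite -convolutionN//; apply: bounded_borel_homo => //; exact: bounded_borelN.
Qed.

Lemma implicit_step_exists phi g :
  {homo phi : x y / x <= y} -> continuous phi ->
  bounded_borel g -> leb.-integrable setT (EFin \o g) ->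
  exists w, [/\ bounded_borel w, leb.-integrable setT (EFin \o w) &
    forall x, w x = g x + c * levy_op nu (phi \o w) x].
Proof.
move=> phind0 phic0 bg ig.
(* Constants are invisible to [levy_op], so [phi 0 = 0] may be arranged. *)
pose phi' r := phi r - phi 0.
have phind : {homo phi' : x y / x <= y} by move=> x y xy; rewrite lerB// phind0.
have phic : continuous phi'.
  by move=> x; apply: continuousB; [exact: phic0|exact: cst_continuous].
have phi0 : phi' 0 = 0 by rewrite /phi' subrr.
have [mg [K hK]] := bg.
have bmax : bounded_borel (fun x => Num.max (g x) 0).
  split; first exact: measurable_maxr.
  by exists K => x; have := hK x; case: (leP (g x) 0); rewrite ?normr0// => _;
    exact: le_trans.
have bmin : bounded_borel (fun x => Num.min (g x) 0).
  split; first exact: measurable_minr.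
  by exists K => x; have := hK x; case: (leP (g x) 0); rewrite ?normr0// => _;
    exact: le_trans.
have imax : leb.-integrable setT (EFin \o (fun x => Num.max (g x) 0)).
  apply: (le_integrable _ _ _ ig) => //; first by apply/measurable_EFinP; case: bmax.
  by move=> x _ /=; rewrite lee_fin; case: (leP (g x) 0); rewrite ?normr0.
have imin : leb.-integrable setT (EFin \o (fun x => Num.min (g x) 0)).
  apply: (le_integrable _ _ _ ig) => //; first by apply/measurable_EFinP; case: bmin.
  by move=> x _ /=; rewrite lee_fin; case: (leP (g x) 0); rewrite ?normr0.
have [|wp [bwp iwp wp0 wpE]] := implicit_step_ge0 phind phic phi0 bmax imax.
  by move=> x; rewrite le_max lexx orbT.
have [|wm [bwm iwm wm0 wmE]] := implicit_step_le0 phind phic phi0 bmin imin.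
  by move=> x; rewrite ge_min lexx orbT.
have [|||w_ [w [_ _ _ _ [bw _ wmp wE]]]] :=
  monotone_iteration phind phic bg bwm bwp.
- by move=> x; rewrite (le_trans (wm0 x)).
- by move=> x; rewrite wmE lerD2r ge_min lexx.
- by move=> x; rewrite wpE lerD2r le_max lexx.
exists w; split => //.
  (* From [wm <= w <= wp] and [wm <= 0 <= wp] follows [|w| <= wp - wm]. *)
  apply: (@le_integrable _ _ _ _ _ _ _ (fun x => (wp x - wm x)%:E)) => //.
  - by apply/measurable_EFinP; case: bw.
  - move=> x _ /=; rewrite lee_fin ler_norml.
    have /andP[? ?] := wmp x; have := wm0 x; have := wp0 x => ? ?.
    by rewrite ger0_norm; [apply/andP; split; lra|lra].
  - exact: (integrableB measurableT iwp iwm).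
move=> x; rewrite (_ : levy_op nu (phi \o w) x = levy_op nu (phi' \o w) x).
  rewrite levy_opE; last exact: bounded_borel_homo.
  by rewrite /=; have := wE x; lra.
by apply: eq_Rintegral => y _; rewrite /phi' /=; ring.
Qed.

End implicit_step_existence.

(** * One implicit step: uniqueness *)

Section implicit_step_uniqueness.
Context {R : realType} {n : nat}.
Local Notation rV := 'rV[R]_n.
Local Notation leb := (@lebesgue_measure_rV R n).
Variables (nu : {finite_measure set rV -> \bar R}) (c : R).
Hypothesis c0 : 0 <= c.
Local Notation m := (total_mass nu).

(* phi o w - phi o v need not be integrable, but its truncation at any level
   delta > 0 is, since it vanishes where w and v are both small. *)
Lemma integrable_truncation (phi : R -> R) (w v : rV -> R) (delta : R) :
  {homo phi : x y / x <= y} -> continuous phi -> 0 < delta ->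
  bounded_borel w -> bounded_borel v ->
  leb.-integrable setT (EFin \o w) -> leb.-integrable setT (EFin \o v) ->
  leb.-integrable setT
    (EFin \o (fun x => Num.max (`|phi (w x) - phi (v x)| - delta) 0)).
Proof.
move=> phind phic delta0 bw bv iw iv.
have bH := bounded_borelB (bounded_borel_homo phind bw) (bounded_borel_homo phind bv).
have [mH [L HL]] := bH.
have L0 : 0 <= L by exact: le_trans (HL 0).
(* Continuity at 0 yields [eta] such that the truncation vanishes where [|w| + |v| < eta]; elsewhere
   the bound [L] is at most [L / eta * (|w| + |v|)]. *)
have /cvgrPdist_lt/(_ (delta / 2)) := phic 0.
rewrite divr_gt0// => /(_ isT) /nbhs_ballP[eta /= eta0 etaP].
have small r : `|r| < eta -> `|phi 0 - phi r| < delta / 2.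
  by move=> r_eta; apply: etaP; rewrite /ball/= sub0r normrN.
apply: (@le_integrable _ _ _ _ _ _ _
    (fun x => (L / eta * (`|w x| + `|v x|))%:E)) => //.
- apply/measurable_EFinP/measurable_maxr => //; apply: measurable_funB => //.
  by apply: measurableT_comp.
- move=> x _ /=; rewrite lee_fin ger0_norm ?le_max ?lexx ?orbT//.
  have wv0 : 0 <= `|w x| + `|v x| by rewrite addr_ge0.
  have ub0 : 0 <= L / eta * (`|w x| + `|v x|).
    by rewrite mulr_ge0// divr_ge0// ltW.
  rewrite (ger0_norm ub0) ge_max ub0 andbT.
  have [wvs|wvb] := ltP (`|w x| + `|v x|) eta.
    have hw : `|phi 0 - phi (w x)| < delta / 2.
      by apply: small; rewrite (le_lt_trans _ wvs)// lerDl.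
    have hv : `|phi 0 - phi (v x)| < delta / 2.
      by apply: small; rewrite (le_lt_trans _ wvs)// lerDr.
    rewrite (@le_trans _ _ 0)//.
    rewrite subr_le0 ler_norml.
    move: hw hv; rewrite !ltr_norml => /andP[? ?] /andP[? ?].
    by apply/andP; split; lra.
  have hLx := HL x; rewrite /= in hLx.
  rewrite (@le_trans _ _ L)//; first by move: hLx delta0; lra.
  by rewrite mulrAC ler_pdivlMr// ler_wpM2l.
- exact: (integrableZl measurableT (L / eta)
    (integrableD measurableT (integrable_norm iw) (integrable_norm iv))).
Qed.

Lemma implicit_step_unique (phi : R -> R) (w v : rV -> R) :
  {homo phi : x y / x <= y} -> continuous phi ->
  bounded_borel w -> bounded_borel v ->
  leb.-integrable setT (EFin \o w) -> leb.-integrable setT (EFin \o v) ->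
  {ae leb, forall x, w x - v x =
     c * (levy_op nu (phi \o w) x - levy_op nu (phi \o v) x)} ->
  {ae leb, forall x, w x = v x}.
Proof.
move=> phind phic bw bv iw iv wv.
have cm0 : 0 <= c * m by rewrite mulr_ge0// total_mass_ge0.
have bpw := bounded_borel_homo phind bw; have bpv := bounded_borel_homo phind bv.
pose H x := phi (w x) - phi (v x).
have bH : bounded_borel H by exact: bounded_borelB.
have {}wv : {ae leb, forall x,
    (w x - v x) + c * m * H x = c * convolution nu H x}.
  apply: filterS wv => x ->.
  by rewrite /H (convolutionB nu x bpw bpv) !levy_opE//=; ring.
have bnH := bounded_borel_norm bH.
have key (delta : R) : 0 < delta ->
    {ae leb, forall x, delta <= `|H x| -> w x = v x}.
  move=> delta0.
  pose p x := Num.max (`|H x| - delta) 0.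
  have p0 x : 0 <= p x by rewrite /p le_max lexx orbT.
  have ip : leb.-integrable setT (EFin \o p) by exact: integrable_truncation.
  have bp : bounded_borel p.
    split; first by apply/measurable_EFinP; exact: measurable_int ip.
    have [_ [K hK]] := bnH; exists K => x; have := hK x.
    rewrite normr_id (ger0_norm (p0 x)) /p ge_max => hKx.
    have Hx0 := normr_ge0 (H x).
    by apply/andP; split; move: hKx delta0; lra.
  pose e x := if delta <= `|H x| then `|w x - v x| else 0.
  have e0 x : 0 <= e x by rewrite /e; case: ifP.
  have me : measurable_fun setT e.
    apply: measurable_fun_ifT => //.
    - by apply: measurable_fun_ler => //; case: bnH.
    - by apply: measurableT_comp => //; case: (bounded_borelB bw bv).
  have ineq : {ae leb, forall x, e x + c * m * p x <= c * convolution nu p x}.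
    apply: filterS wv => x wvx.
    have cp0 : 0 <= c * convolution nu p x.
      by rewrite mulr_ge0// convolution_ge0.
    (* As [phi] is nondecreasing, [H x] never has the sign opposite to [w x - v x], so absolute
       values add. *)
    have sgn : `|w x - v x| + c * m * `|H x| = `|(w x - v x) + c * m * H x|.
      have [vw|wv'] := leP (v x) (w x).
        have h : 0 <= H x by rewrite subr_ge0 phind.
        have h' : 0 <= w x - v x by rewrite subr_ge0.
        by rewrite (ger0_norm h) (ger0_norm h') ger0_norm// addr_ge0// mulr_ge0.
      have h : H x <= 0 by rewrite subr_le0 phind// ltW.
      have h' : w x - v x <= 0 by rewrite subr_le0 ltW.
      have h2 : c * m * H x <= 0 by rewrite mulr_ge0_le0.
      rewrite (ler0_norm h) (ler0_norm h') ler0_norm; last by move: h' h2; lra.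
      by ring.
    (* Pointwise [|H| <= p + delta], and the constant [delta] contributes [delta * m] to the
       convolution. *)
    have up : `|w x - v x| + c * m * `|H x| <=
        c * (convolution nu p x + delta * m).
      rewrite sgn wvx normrM ger0_norm// ler_wpM2l//.
      rewrite (le_trans (norm_convolution nu x bH))//.
      rewrite -lerBlDr -(convolution_cst nu delta x).
      rewrite -(convolutionB nu x bnH (bounded_borel_cst delta)).
      apply: le_convolution => //.
        exact: bounded_borelB bnH (bounded_borel_cst delta).
      by move=> y; rewrite /p le_max lexx.
    (* Below the level [delta] the left side is 0; above it [p x = |H x| - delta], and the two terms
       [c * m * delta] cancel. *)
    rewrite /e /p; case: ifPn => [dH|]; last first.
      rewrite -ltNge => /ltW Hd; rewrite max_r ?subr_le0//.
      by rewrite mulr0 addr0.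
    by rewrite max_l ?subr_ge0//; move: up; lra.
  have mp : measurable_fun setT p by case: bp.
  (* Finiteness is what the truncation buys: this term can be cancelled from both sides. *)
  have Ioo : ((c * m)%:E * \int[leb]_x (p x)%:E \is a fin_num)%E.
    rewrite fin_numM//; exact: integrable_fin_num ip.
  have : (\int[leb]_x (e x)%:E + (c * m)%:E * \int[leb]_x (p x)%:E <=
      (c * m)%:E * \int[leb]_x (p x)%:E)%E.
    rewrite [leRHS](_ : _ = \int[leb]_x (c * convolution nu p x)%:E)%E; last first.
      under [RHS]eq_integral do rewrite EFinM.
      rewrite ge0_integralZl_EFin//.
      - by rewrite ge0_integral_convolution// muleA -EFinM.
      - by move=> x _; rewrite lee_fin convolution_ge0.
      - by apply/measurable_EFinP; case: (bounded_borel_convolution nu bp).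
    rewrite -ge0_integralZl_EFin//; last 2 first.
    - by move=> x _; rewrite lee_fin.
    - exact/measurable_EFinP.
    rewrite -ge0_integralD//; last 4 first.
    - by move=> x _; rewrite lee_fin.
    - exact/measurable_EFinP.
    - by move=> x _; rewrite -EFinM lee_fin mulr_ge0.
    - exact/measurable_funeM/measurable_EFinP.
    apply: ae_ge0_le_integral => //.
    - by move=> x _; rewrite adde_ge0 -?EFinM ?lee_fin// mulr_ge0.
    - apply: emeasurable_funD; first exact/measurable_EFinP.
      exact/measurable_funeM/measurable_EFinP.
    - by move=> x _; rewrite lee_fin mulr_ge0// convolution_ge0.
    - apply/measurable_EFinP/measurable_funM => //.
      by case: (bounded_borel_convolution nu bp).
    - by apply: filterS ineq => x ex _; rewrite -EFinM -EFinD lee_fin.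
  rewrite -[leRHS]add0e leeD2rE// => e_le0.
  have : ae_eq leb setT (EFin \o e) (cst 0%E).
    apply/ae_eq_integral_abs => //; first exact/measurable_EFinP.
    apply/eqP; rewrite eq_le; apply/andP; split; last exact: integral_ge0.
    rewrite (le_trans _ e_le0)//.
    by under eq_integral do rewrite gee0_abs ?lee_fin//.
  apply: filterS => x /(_ I) /= [] + dH; rewrite /e dH => /eqP.
  by rewrite normr_eq0 subr_eq0 => /eqP.
have H0 : {ae leb, forall x, H x = 0}.
  (* Countably many levels suffice, so the exceptional sets still have a null union. *)
  have : {ae leb, forall x, forall i, i.+1%:R^-1 <= `|H x| -> w x = v x}.
    by apply/ae_foralln => i; apply: key; rewrite invr_gt0.
  apply: filterS => x wvi; apply/eqP/negPn/negP => Hx0.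
  suff wvx : w x = v x by move: Hx0; rewrite /H wvx subrr eqxx.
  have Hx_gt0 : 0 < `|H x| by rewrite normr_gt0.
  apply: (wvi (Num.truncn (`|H x|^-1))).
  rewrite -[leRHS]invrK lef_pV2 ?posrE ?invr_gt0//.
  by rewrite ltW// truncnS_gt.
(* Since [H] also vanishes at [nu]-a.e. shift of a.e. [x], the equation reduces to
   [w x - v x = 0]. *)
have H0s := ae_shift nu H0.
near=> x.
have Hx : H x = 0 by near: x.
have Hxz : {ae nu, forall z, H (x + z) = 0} by near: x.
have wvx : (w x - v x) + c * m * H x = c * convolution nu H x by near: x.
apply/eqP; rewrite -subr_eq0; apply/eqP.
move: wvx; rewrite Hx mulr0 addr0 => ->.
rewrite (_ : convolution nu H x = 0) ?mulr0//.
rewrite /convolution /Rintegral (ae_eq_integral (cst 0%E))//.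
- by rewrite integral0.
- by apply/measurable_EFinP; case: (bounded_borel_shift x bH).
- by apply: filterS Hxz => z /= ->.
Unshelve. all: by end_near. Qed.

End implicit_step_uniqueness.

(** * Representatives in L^1 and L^oo, and the source term *)

Section nonmeasurable_integral.
Context d (T : measurableType d) {R : realType}.
Variable mu : {measure set T -> \bar R}.
Local Open Scope ereal_scope.

(* The source f is only a.e. equal to a Borel function, so its sections need not
   be measurable; the integral is then a supremum over simple functions below,
   which is still monotone and insensitive to null sets. *)
Lemma ge0_le_lower_integral (D E : set T) (f g : T -> \bar R) : D `<=` E ->
  (forall x, D x -> 0 <= f x) -> (forall x, E x -> 0 <= g x) ->
  (forall x, D x -> f x <= g x) ->
  \int[mu]_(x in D) f x <= \int[mu]_(x in E) g x.
Proof.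
move=> DE f0 g0 fg; rewrite integral_mkcond [leRHS]integral_mkcond.
rewrite !ge0_integralTE; last 2 first.
- by apply: erestrict_ge0.
- by apply: erestrict_ge0.
apply: le_ereal_sup => _ /= [h hf <-]; exists h => // x.
rewrite (le_trans (hf x))// !patchE.
have [Dx|Dx] := boolP (x \in D).
  by move: Dx; rewrite inE => Dx; rewrite mem_set ?fg//; exact: DE.
by case: ifPn => //; rewrite inE; exact: g0.
Qed.

(** From below, discarding the null set does not change the integral of the measurable [g]. From
    above, [f] is dominated by the measurable [k], which is infinite on the null set and equal to
    [g] elsewhere. *)
Lemma ge0_ae_eq_lower_integral (D : set T) (f g : T -> \bar R) :
  measurable D -> measurable_fun D g ->
  (forall x, D x -> 0 <= f x) -> (forall x, D x -> 0 <= g x) ->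
  ae_eq mu D f g -> \int[mu]_(x in D) f x = \int[mu]_(x in D) g x.
Proof.
move=> mD mg f0 g0 [N [mN N0 fgN]].
have fg x : D x -> ~ N x -> f x = g x.
  by move=> Dx Nx; apply: contrapT => fgx; apply/Nx/fgN => /(_ Dx).
apply/eqP; rewrite eq_le; apply/andP; split; last first.
  rewrite (ge0_negligible_integral _ _ _ _ N0)//.
  apply: ge0_le_lower_integral => //.
  - by move=> x [Dx _]; exact: g0.
  - by move=> x [Dx Nx]; rewrite fg.
pose k x := if x \in N then +oo else g x.
have mk : measurable_fun D k.
  apply: measurable_fun_if => //.
  - apply: (@measurable_funTS _ _ _ _ D (fun x => x \in N)).
    apply: (measurable_fun_bool true); rewrite setTI.
    rewrite (_ : _ @^-1` _ = N)//.
    by apply/seteqP; split => x; [exact: set_mem|exact: mem_set].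
  - by apply: measurable_funS mg => //; exact: subIsetl.
rewrite (@ge0_ae_eq_integral _ _ _ mu D g k)//.
- apply: ge0_le_lower_integral => // x Dx; rewrite /k; case: ifPn => //.
  + by move=> _; rewrite g0.
  + by move=> _; rewrite leey.
  + by rewrite notin_setE => Nx; rewrite fg.
- by move=> x Dx; rewrite /k; case: ifPn => // _; exact: g0.
- exists N; split => // x /= nk; apply: contrapT => Nx.
  by apply: nk => Dx; rewrite /k memNset.
Qed.

Lemma ae_eq_lower_integral (D : set T) (f g : T -> \bar R) :
  measurable D -> measurable_fun D g ->
  ae_eq mu D f g -> \int[mu]_(x in D) f x = \int[mu]_(x in D) g x.
Proof.
move=> mD mg fg; have [fgp fgn] := (ae_eq_funeposneg _ _ _ _).1 fg.
rewrite integralE [RHS]integralE; congr (_ - _).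
- by apply: ge0_ae_eq_lower_integral => //; exact: measurable_funepos.
- by apply: ge0_ae_eq_lower_integral => //; exact: measurable_funeneg.
Qed.

End nonmeasurable_integral.

Section lebesgue_Linfty.
Context {R : realType} {n : nat}.
Local Notation rV := 'rV[R]_n.
Local Notation leb := (@lebesgue_measure_rV R n).

(** Needed because the L^oo norm is an essential supremum only over a space of positive measure;
    otherwise it defaults to 0. *)
Lemma lebesgue_measure_rV_setT_gt0 : (0 < leb setT)%E.
Proof.
have := @lebesgue_measure_rV_box R n (fun=> setT) (fun=> measurableT).
rewrite (_ : mkset _ = setT); last by apply/seteqP.
move=> ->; apply: (big_ind (fun x => 0 < x)%E) => //.
- exact: mule_gt0.
- move=> i _; rewrite (_ : setT = [set` `]-oo, +oo[]); last by rewrite set_itvE.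
  by rewrite lebesgue_measure_itv/= addey// ltry.
Qed.

Lemma L1_Linfty_bounded_borel (v : rV -> R) :
  bounded_borel v -> leb.-integrable setT (EFin \o v) -> L1_Linfty v.
Proof.
move=> [mv [K hK]] iv; split; first exact/Lfun1_integrable.
rewrite inE; apply/andP; split; rewrite inE//=.
rewrite /finite_norm unlock lebesgue_measure_rV_setT_gt0.
rewrite (@le_lt_trans _ _ K%:E) ?ltry//; apply/ess_supP/nearW => x /=.
by rewrite lee_fin.
Qed.

(** The representative [v] is [u] set to 0 where it exceeds its essential supremum in absolute
    value. *)
Lemma L1_Linfty_representative (u : rV -> R) : L1_Linfty u ->
  measurable_fun setT u /\
  exists v, [/\ bounded_borel v, leb.-integrable setT (EFin \o v) &
    {ae leb, forall x, u x = v x}].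
Proof.
move=> [/Lfun1_integrable iu].
rewrite inE => /andP[]; rewrite !inE/= => mu.
rewrite /finite_norm unlock lebesgue_measure_rV_setT_gt0 => uoo.
split; first by [].
have := ess_sup_ge leb (abse \o (EFin \o u)).
have : (0 <= ess_sup leb (abse \o (EFin \o u)))%E.
  apply: ess_sup_gee; first exact: lebesgue_measure_rV_setT_gt0.
  by apply: nearW => x /=; rewrite lee_fin.
move: uoo; case: (ess_sup _ _) => [K| |]// _; rewrite lee_fin => K0 uK.
pose v x := if `|u x| <= K then u x else 0.
have mv : measurable_fun setT v.
  apply: measurable_fun_ifT => //; apply: measurable_fun_ler => //.
  exact: measurableT_comp.
exists v; split.
- split => //; exists K => x; rewrite /v; case: ifPn => //.
  by rewrite normr0.
- apply: (le_integrable _ _ _ iu) => //; first exact/measurable_EFinP.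
  by move=> x _ /=; rewrite lee_fin /v; case: ifPn; rewrite ?normr0.
- by apply: filterS uK => x /=; rewrite lee_fin /v => ->.
Qed.

End lebesgue_Linfty.

(** * The time integral of the source and the time grid *)

Section source.
Context {R : realType} {n : nat}.
Local Notation rV := 'rV[R]_n.
Local Notation leb := (@lebesgue_measure_rV R n).
Local Notation leb1 := (@lebesgue_measure R).

Lemma Lnorm_infty_ess_sup (u : rV -> \bar R) :
  ('N[leb]_+oo[u] = ess_sup leb (abse \o u))%E.
Proof. by rewrite unlock lebesgue_measure_rV_setT_gt0. Qed.

(** The essential supremum exceeds [a] exactly when the section of the superlevel set at [a] has
    positive measure, and section measures are measurable. *)
Lemma measurable_ess_sup_section d (T : measurableType d) (h : rV * T -> \bar R) :
  measurable_fun setT h ->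
  measurable_fun setT (fun s => ess_sup leb (fun x => h (x, s))).
Proof.
move=> mh; apply: (measurability _ (ErealGenOInfty.measurableE R)).
move=> _ [_ [a ->] <-]; rewrite setTI.
pose A := h @^-1` `]a%:E, +oo[%classic.
have mA : measurable A.
  by rewrite -[A]setTI; apply: mh => //; exact: emeasurable_itv.
rewrite (_ : _ @^-1` _ = [set s | leb (ysection A s) != 0%E]).
  have := @measurable_fun_ysection _ _ _ _ R leb A mA.
  move=> /(_ measurableT [set~ 0%E]) /(_ (measurableC (emeasurable_set1 0%E))).
  rewrite setTI; congr (measurable _).
  by apply/seteqP; split=> s /= /eqP.
have msec s : measurable_fun setT (fun x => h (x, s)) by exact: measurableT_comp.
apply/seteqP; split=> s /=.
  rewrite in_itv/= andbT => aess; apply/eqP => A0.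
  move: aess; rewrite ltNge => /negP; apply; apply/ess_supP.
  apply/ae_le_measureP => //; rewrite -[RHS]A0; congr (leb _).
  by apply/seteqP; split=> x; [move=> hx; apply/ysectionP|move=> /ysectionP].
move=> /eqP A0; rewrite in_itv/= andbT ltNge; apply/negP => /ess_supP.
move=> /(ae_le_measureP _ _ (msec s)) h0; apply: A0; rewrite -[RHS]h0; congr (leb _).
by apply/seteqP; split=> x; [move=> /ysectionP|move=> hx; apply/ysectionP].
Qed.

(** Fubini for a Borel version [g'] of the source gives an integrable [Phi]. It is a.e. bounded by
    the time integral [C] of the L^oo norms, and [F] is [Phi] cut off at [C]. *)
Lemma time_integral_representative (f : rV -> R -> R) (T a b : R) :
  source_integrable f T -> 0 <= a -> b <= T ->
  exists F, [/\ bounded_borel F, leb.-integrable setT (EFin \o F) &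
    {ae leb, forall x, \int[leb1]_(s in `]a, b[) f x s = F x}].
Proof.
move=> [[g mg fg] Noo] a0 bT.
pose I : set (measurableTypeR R) := `]a, b[%classic.
have mI : measurable I by exact: measurable_itv.
have ID : I `<=` `]0, T[%classic.
  move=> s; rewrite /I/= !in_itv/= => /andP[sa sb].
  by rewrite (le_lt_trans a0)//= (lt_le_trans sb).
pose TI : set (rV * measurableTypeR R) := [set: rV] `*` I.
have mTI : measurable TI by exact: measurableX.
pose g' := g \_ TI.
have mg' : measurable_fun setT g'.
  apply/(measurable_restrictT _ mTI); apply: measurable_funS mg => //.
    by apply: measurableX => //; exact: measurable_itv.
  by move=> [x s] [_ /ID].
have fg' : {ae (leb \x leb1)%E, forall p, I p.2 -> f p.1 p.2 = g' p}.
  apply: filterS fg => -[x s] /= fgxs Is.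
  by rewrite fgxs; [rewrite /g' patchE mem_set//|split => //; exact: ID].
have fg1 := @ae_product1 _ _ _ _ R leb leb1 _ fg'.
have fg2 := @ae_product2 _ _ _ _ R leb leb1 _ fg'.
have g'0 x s : ~ I s -> g' (x, s) = 0.
  by move=> Is; rewrite /g' patchE memNset//; case.
pose ag p : \bar R := `|(g' p)%:E|%E.
have mag : measurable_fun setT ag.
  by apply: measurableT_comp => //; exact/measurable_EFinP.
have ag0 p : (0 <= ag p)%E by exact: abse_ge0.
(* [G1] and [Goo] are measurable stand-ins for the L^1 and L^oo norms of the sections of [f], equal
   to them for a.e. [s] in [I]. *)
pose G1 s := (\int[leb]_x ag (x, s))%E.
pose Goo s := ess_sup leb (fun x => ag (x, s)).
have mG1 : measurable_fun setT G1 by exact: measurable_fun_fubini_tonelli_G.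
have mGoo : measurable_fun setT Goo by exact: measurable_ess_sup_section.
have G10 s : (0 <= G1 s)%E by exact: integral_ge0.
have Goo0 s : (0 <= Goo s)%E.
  apply: ess_sup_gee; first exact: lebesgue_measure_rV_setT_gt0.
  exact: nearW.
pose N s := ('N[leb]_1[EFin \o f ^~ s] + 'N[leb]_+oo[EFin \o f ^~ s])%E.
have N0 s : (0 <= N s)%E by rewrite adde_ge0// Lnorm_ge0.
have NE : ae_eq leb1 I N (G1 \+ Goo)%E.
  apply: filterS fg2 => s fgs Is; rewrite /N Lnorm1 Lnorm_infty_ess_sup /=.
  have fgs' : {ae leb, forall x, f x s = g' (x, s)} by apply: filterS fgs => x; exact.
  congr (_ + _)%E.
    apply: ge0_ae_eq_lower_integral => //; first exact: measurableT_comp mag _.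
    by apply: filterS fgs' => x /= -> _.
  by apply: eq_ess_sup; apply: filterS fgs' => x /= ->.
have GIoo : (\int[leb1]_(s in I) (G1 s + Goo s) < +oo)%E.
  apply: le_lt_trans Noo.
  rewrite -(ge0_ae_eq_lower_integral mI _ _ _ NE)//; last 2 first.
  - by apply: measurable_funTS; exact: emeasurable_funD.
  - by move=> s _; rewrite adde_ge0.
  apply: (@ge0_le_lower_integral _ _ _ _ I _ N N) => //.
rewrite ge0_integralD// in GIoo; [|exact: measurable_funTS..].
have G1oo : (\int[leb1]_s G1 s < +oo)%E.
  rewrite (_ : integral _ _ _ = \int[leb1]_(s in I) G1 s)%E.
    by apply: le_lt_trans GIoo; rewrite leeDl// integral_ge0.
  rewrite [RHS]integral_mkcond; apply: eq_integral => s _; rewrite patchE.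
  case: ifPn => //; rewrite notin_setE => Is.
  rewrite /G1 integral0_eq// => x _.
  by rewrite /ag g'0// abse0.
have Gooo : (\int[leb1]_(s in I) Goo s < +oo)%E.
  by apply: le_lt_trans GIoo; rewrite leeDr// integral_ge0.
pose C := fine (\int[leb1]_(s in I) Goo s)%E.
have CE : (\int[leb1]_(s in I) Goo s = C%:E)%E.
  by rewrite fineK// ge0_fin_numE// integral_ge0.
have C0 : 0 <= C by rewrite fine_ge0// integral_ge0.
have ig' : (leb \x leb1)%E.-integrable setT (EFin \o g').
  by apply/integrable21ltyP; first exact/measurable_EFinP.
pose Phi := fubini_F leb1 (EFin \o g').
have iPhi : leb.-integrable setT Phi by exact: integrable_fubini_F.
have mPhi : measurable_fun setT Phi by exact: measurable_int iPhi.
pose F x := if (`|Phi x| <= C%:E)%E then fine (Phi x) else 0.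
have FE x : (`|(F x)%:E| <= `|Phi x|)%E.
  rewrite /F; case: ifPn => [h|_]; last by rewrite abse0.
  by rewrite fineK// fin_num_abs (le_lt_trans h)// ltry.
have mF : measurable_fun setT F.
  apply: measurable_fun_ifT => //.
    by apply: measurable_fun_lee => //; exact: measurableT_comp.
  exact: measurableT_comp.
exists F; split.
- split => //; exists C => x; rewrite /F; case: ifPn; last by rewrite normr0.
  case: (Phi x) => [r| |] //=; rewrite ?normr0// lee_fin.
- apply: (le_integrable _ _ _ iPhi) => //; first exact/measurable_EFinP.
  by move=> x _; exact: FE.
(* For each [s] the bound holds for a.e. [x]; passing through the product measure gives it, for a.e.
   [x], at a.e. [s]. *)
have agGoo : {ae (leb \x leb1)%E, forall p, (ag p <= Goo p.2)%E}.
  pose A := (fun p => (ag p <= Goo p.2)%E) @^-1` [set false].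
  have mA : measurable A.
    rewrite -[A]setTI; apply: measurable_fun_lee => //.
    exact: measurableT_comp.
  exists A; split => //.
    apply: product_measure_eq0 => //; apply: nearW => s.
    have := ess_sup_ge leb (fun x => ag (x, s)).
    move=> [B [mB B0 hB]]; apply: (subset_measure0 _ mB) => //.
      exact: measurable_ysection.
    by move=> x /ysectionP/= As; apply: hB => /=; rewrite As.
  by move=> p /negP/negbTE.
have agGoo1 := @ae_product1 _ _ _ _ R leb leb1 _ agGoo.
near=> x.
have fgx : {ae leb1, forall s, I s -> f x s = g' (x, s)} by near: x.
have agx : {ae leb1, forall s, (ag (x, s) <= Goo s)%E} by near: x.
have mgx : measurable_fun setT (fun s => (g' (x, s))%:E).
  by apply: (@measurableT_comp _ _ _ _ _ _ (EFin \o g')) => //; exact/measurable_EFinP.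
have PhiE : Phi x = (\int[leb1]_(s in I) (g' (x, s))%:E)%E.
  rewrite [RHS]integral_mkcond; apply: eq_integral => s _; rewrite patchE.
  by case: ifPn => //; rewrite notin_setE => Is /=; rewrite g'0.
have intE : (\int[leb1]_(s in I) (f x s)%:E = Phi x)%E.
  rewrite PhiE; apply: ae_eq_lower_integral => //; first exact: measurable_funTS.
  by apply: filterS fgx => s fgs Is; rewrite fgs.
have PhiC : (`|Phi x| <= C%:E)%E.
  rewrite PhiE -CE (le_trans (le_abse_integral _ _ _))//.
    exact: measurable_funTS.
  apply: ae_ge0_le_integral => //.
  - by apply: measurableT_comp => //; exact: measurable_funTS.
  - exact: measurable_funTS.
  - by apply: filterS agx => s.
by rewrite /F PhiC /Rintegral intE.
Unshelve. all: by end_near. Qed.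

Lemma time_grid_ge0 (t : nat -> R) (T : R) (J j : nat) :
  time_grid t T J -> (j <= J)%N -> 0 <= t j.
Proof.
move=> [t0 _ tS]; elim: j => [|j ih] jJ; first by rewrite t0.
by rewrite (le_trans (ih (ltnW jJ)))// ltW// tS.
Qed.

Lemma time_grid_le (t : nat -> R) (T : R) (J j : nat) :
  time_grid t T J -> (j <= J)%N -> t j <= T.
Proof.
move=> [_ <- tS] jJ.
suff H k : (k <= J - j)%N -> t j <= t (j + k)%N.
  by rewrite -[in leRHS](subnKC jJ) H.
elim: k => [|k ih] kJ; first by rewrite addn0.
rewrite addnS (le_trans (ih (ltnW kJ)))// ltW// tS//.
by rewrite -ltn_subRL.
Qed.

End source.

(** * The scheme *)

(** Near 0 this is the local Lipschitz bound; for [|r| >= e], monotonicity bounds the difference by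
    the oscillation [L], which is at most [L / e * |r|]. *)
Lemma locally_lipschitz_homo_bound {R : realType} (phi : R -> R) (K : R) :
  {homo phi : x y / x <= y} -> [locally lipschitz phi] ->
  exists2 C, 0 <= C & forall r, `|r| <= K -> `|phi r - phi 0| <= C * `|r|.
Proof.
move=> phind /(_ (0, 0) (conj I I)) /pinfty_ex_gt0[M M0].
move=> [[A B] /= [nA nB] AB].
have [e /= e0 eA] := (nbhs_ballP _ _).1 nA.
have lip r : `|r| < e -> `|phi r - phi 0| <= M * `|r|.
  move=> re; have := AB (r, 0); rewrite /= subr0; apply; last by [].
  by split; [apply: eA; rewrite /ball/= sub0r normrN|exact: nbhs_singleton nB].
pose L := `|phi K - phi (- K)|.
have L0 : 0 <= L by exact: normr_ge0.
have Le0 : 0 <= L / e by rewrite divr_ge0// ltW.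
exists (M + L / e) => [|r rK]; first by rewrite addr_ge0// ltW.
rewrite mulrDl; have [re|er] := ltP `|r| e.
  by rewrite (le_trans (lip r re))// lerDl mulr_ge0.
rewrite (@le_trans _ _ L)//; last first.
  rewrite (@le_trans _ _ (L / e * `|r|))//; last by rewrite lerDr mulr_ge0// ltW.
  by rewrite mulrAC ler_pdivlMr// ler_wpM2l.
have K0 : 0 <= K by exact: le_trans rK.
have h1 : phi 0 <= phi K by exact: phind.
have h2 : phi (- K) <= phi 0 by rewrite phind// oppr_le0.
have /ler_normlP[rl ru] := rK.
have h3 : phi r <= phi K by exact: phind.
have h4 : phi (- K) <= phi r by rewrite phind// lerNl.
have := ler_norm (phi K - phi (- K)); rewrite -/L => hL.
by rewrite ler_norml; apply/andP; split; lra.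
Qed.

Section scheme_step.
Context {R : realType} {n : nat}.
Local Notation rV := 'rV[R]_n.
Local Notation leb := (@lebesgue_measure_rV R n).
Implicit Types (nu : {finite_measure set rV -> \bar R}) (u v w F S : rV -> R).

(** The constant [phi 0] drops out of [levy_op], and [phi \o v - phi 0] is dominated by a multiple
    of [|v|]. *)
Lemma integrable_levy_op nu (phi : R -> R) v :
  {homo phi : x y / x <= y} -> [locally lipschitz phi] ->
  bounded_borel v -> leb.-integrable setT (EFin \o v) ->
  leb.-integrable setT (EFin \o levy_op nu (phi \o v)).
Proof.
move=> phind philip bv iv; have [mv [K hK]] := bv.
have [C C0 hC] := locally_lipschitz_homo_bound K phind philip.
pose psi x := phi (v x) - phi 0.
have bpsi : bounded_borel psi.
  exact: bounded_borelB (bounded_borel_homo phind bv) (bounded_borel_cst _).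
have ipsi : leb.-integrable setT (EFin \o psi).
  apply: (le_integrable _ _ _ (integrableZl measurableT C iv)) => //.
    by apply/measurable_EFinP; case: bpsi.
  by move=> x _ /=; rewrite lee_fin normrM (ger0_norm C0); exact: hC.
have -> : levy_op nu (phi \o v) =
    fun x => convolution nu psi x - total_mass nu * psi x.
  apply/funext => x; rewrite -levy_opE//.
  by apply: eq_Rintegral => y _; rewrite /psi /=; ring.
exact: (integrableB measurableT (integrable_convolution nu bpsi ipsi)
  (integrableZl measurableT (total_mass nu) ipsi)).
Qed.

Variables (nu1 nu2 : {finite_measure set rV -> \bar R}) (phi1 phi2 : R -> R).
Hypotheses (phi1nd : {homo phi1 : x y / x <= y}) (phi1c : continuous phi1)
  (phi2nd : {homo phi2 : x y / x <= y}) (phi2lip : [locally lipschitz phi2]).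
Variable dt : R.
Hypothesis dt0 : 0 <= dt.

Definition ae_step S u w := {ae leb, forall x, w x = u x + dt *
  (levy_op nu1 (phi1 \o w) x + levy_op nu2 (phi2 \o u) x + S x)}.

(** The explicit terms, built from the representatives [v] and [F], form the datum of an implicit
    equation solved everywhere; going back to [u] and [S] costs a null set. *)
Lemma ae_step_exists S F u :
  bounded_borel F -> leb.-integrable setT (EFin \o F) ->
  {ae leb, forall x, S x = F x} -> L1_Linfty u ->
  exists2 w, L1_Linfty w & ae_step S u w.
Proof.
move=> bF iF SF /L1_Linfty_representative[mu [v [bv iv uv]]].
have bL := bounded_borel_levy_op nu2 (bounded_borel_homo phi2nd bv).
have iL := integrable_levy_op nu2 phi2nd phi2lip bv iv.
have [w [bw iw wE]] := implicit_step_exists nu1 dt0 phi1nd phi1c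
  (bounded_borelD bv (bounded_borelZ dt (bounded_borelD bL bF)))
  (integrableD measurableT iv
    (integrableZl measurableT dt (integrableD measurableT iL iF))).
exists w; first exact: L1_Linfty_bounded_borel.
have mv : measurable_fun setT v by case: bv.
have uvL := ae_eq_levy_op nu2 phi2nd mu mv uv.
near=> x.
have -> : u x = v x by near: x.
have -> : S x = F x by near: x.
have -> : levy_op nu2 (phi2 \o u) x = levy_op nu2 (phi2 \o v) x by near: x.
by rewrite [LHS]wE; ring.
Unshelve. all: by end_near. Qed.

(** The previous values need only agree a.e., so that the lemma can be iterated in time. *)
Lemma ae_step_unique S u u' w w' :
  L1_Linfty u -> L1_Linfty u' -> L1_Linfty w -> L1_Linfty w' ->
  {ae leb, forall x, u x = u' x} -> ae_step S u w -> ae_step S u' w' ->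
  {ae leb, forall x, w x = w' x}.
Proof.
move=> /L1_Linfty_representative[mu _] /L1_Linfty_representative[mu' _].
move=> /L1_Linfty_representative[mw [v [bv iv wv]]].
move=> /L1_Linfty_representative[mw' [v' [bv' iv' wv']]] uu' wE wE'.
have uuL := ae_eq_levy_op nu2 phi2nd mu mu' uu'.
have wvL := ae_eq_levy_op nu1 phi1nd mw bv.1 wv.
have wvL' := ae_eq_levy_op nu1 phi1nd mw' bv'.1 wv'.
have vv' : {ae leb, forall x, v x = v' x}.
  apply: (implicit_step_unique (nu := nu1) dt0 phi1nd phi1c bv bv' iv iv').
  near=> x.
  have <- : w x = v x by near: x.
  have <- : w' x = v' x by near: x.
  have <- : levy_op nu1 (phi1 \o w) x = levy_op nu1 (phi1 \o v) x by near: x.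
  have <- : levy_op nu1 (phi1 \o w') x = levy_op nu1 (phi1 \o v') x by near: x.
  have -> : w x = u x + dt * (levy_op nu1 (phi1 \o w) x +
      levy_op nu2 (phi2 \o u) x + S x) by near: x.
  have -> : w' x = u' x + dt * (levy_op nu1 (phi1 \o w') x +
      levy_op nu2 (phi2 \o u') x + S x) by near: x.
  have -> : u x = u' x by near: x.
  have -> : levy_op nu2 (phi2 \o u) x = levy_op nu2 (phi2 \o u') x by near: x.
  by ring.
near=> x.
have -> : w x = v x by near: x.
have -> : w' x = v' x by near: x.
by near: x.
Unshelve. all: by end_near. Qed.

End scheme_step.

Theorem theorem2p4 (R : realType) (N : nat) (T : R) (J : nat) (t : nat -> R)
    (u0 : 'rV[R]_N -> R) (f : 'rV[R]_N -> R -> R)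
    (nu1 nu2 : {finite_measure set 'rV[R]_N -> \bar R}) (phi1 phi2 : R -> R) :
  0 < T ->
  time_grid t T J ->
  L1_Linfty u0 ->
  source_integrable f T ->
  admissible u0 f T t J nu1 nu2 phi1 phi2 ->
  (exists U : nat -> 'rV[R]_N -> R,
      ae_solution u0 f t J nu1 nu2 phi1 phi2 U /\
      forall j, (1 <= j <= J)%N -> L1_Linfty (U j)) /\
  (forall U V : nat -> 'rV[R]_N -> R,
      ae_solution u0 f t J nu1 nu2 phi1 phi2 U ->
      (forall j, (1 <= j <= J)%N -> L1_Linfty (U j)) ->
      ae_solution u0 f t J nu1 nu2 phi1 phi2 V ->
      (forall j, (1 <= j <= J)%N -> L1_Linfty (V j)) ->
      forall j, (1 <= j <= J)%N ->
        {ae lebesgue_measure_rV N, forall x, U j x = V j x}).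
Proof.
move=> _ grid Lu0 fint [_ _ phi1nd phi1c phi2nd phi2lip _].
have dt0 j : (j < J)%N -> 0 <= time_step t j.+1.
  by case: grid => _ _ tS jJ; rewrite subr_ge0 ltW// tS.
split.
  have step_ j u : exists w, (j < J)%N -> L1_Linfty u -> L1_Linfty w /\
      ae_step nu1 nu2 phi1 phi2 (time_step t j.+1) (source_mean f t j.+1) u w.
    have [[jJ Lu]|nojL] := pselect ((j < J)%N /\ L1_Linfty u); last first.
      (* The witness is arbitrary here; it makes the step total, so that choice yields a function of
         all pairs [(j, u)]. *)
      by exists u => jJ Lu; exfalso; apply: nojL.
    have [F0 [bF0 iF0 F0E]] := time_integral_representative fint
      (time_grid_ge0 grid (ltnW jJ)) (time_grid_le grid jJ).
    pose s := (time_step t j.+1)^-1.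
    have [|w Lw wE] := ae_step_exists nu1 nu2 phi1nd phi1c phi2nd phi2lip
      (dt0 j jJ) (S := source_mean f t j.+1) (bounded_borelZ s bF0)
      (integrableZl measurableT s iF0) _ Lu.
      by apply: filterS F0E => x F0x; rewrite /source_mean F0x.
    by exists w.
  have /choice[step stepP] : forall ju : nat * ('rV[R]_N -> R), exists w,
      (ju.1 < J)%N -> L1_Linfty ju.2 -> L1_Linfty w /\
      ae_step nu1 nu2 phi1 phi2 (time_step t ju.1.+1)
        (source_mean f t ju.1.+1) ju.2 w.
    by move=> [j u]; exact: step_.
  pose U := fix U j := if j is i.+1 then step (i, U i) else u0.
  have LU j : (j <= J)%N -> L1_Linfty (U j).
    by elim: j => // j ih jJ; exact: (stepP (j, U j) jJ (ih (ltnW jJ))).1.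
  exists U; split; last by move=> j /andP[_ jJ]; exact: LU.
  split => // -[//|j] /andP[_ jJ].
  exact: (stepP (j, U j) jJ (LU j (ltnW jJ))).2.
move=> U V [U0 UE] LU [V0 VE] LV j /andP[_].
(* Index 0 is included through the initial datum, since each step also refers to the previous
   value. *)
have LU' i : (i <= J)%N -> L1_Linfty (U i).
  by case: i => [_|i iJ]; [rewrite U0|exact: LU].
have LV' i : (i <= J)%N -> L1_Linfty (V i).
  by case: i => [_|i iJ]; [rewrite V0|exact: LV].
elim: j => [_|j ih jJ]; first by rewrite U0 V0; exact: nearW.
have jJ' := ltnW jJ.
exact: (ae_step_unique phi1nd phi1c phi2nd (dt0 j jJ) (LU' _ jJ') (LV' _ jJ')
  (LU' _ jJ) (LV' _ jJ) (ih jJ') (UE j.+1 jJ) (VE j.+1 jJ)).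
Qed.
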